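(* Let $\lambda$ be a partition of a positive integer $l$, let $\Lambda^\circ$ be the column tableau of shape $\lambda$, and let $V_\lambda=H_lF_{\Lambda^\circ}$ be the left ideal of $H_l$ generated by the element $F_{\Lambda^\circ}$, regarded as an $H_l$-module via left multiplication. Then the $H_l$-module $V_\lambda$ is irreducible.
   Context: Let $q$ be a formal parameter. $H_l$ is the $\mathbb{C}(q)$-algebra with generators $T_1,\ldots,T_{l-1}$ and relations $(T_i-q)(T_i+q^{-1})=0$; $T_iT_{i+1}T_i=T_{i+1}T_iT_{i+1}$; $T_iT_j=T_jT_i$ for $|i-j|\ge2$. The Young diagram of $\lambda$ is $\{(a,b)\in\mathbb{Z}^2: 1\le a,\ 1\le b\le\lambda_a\}$. A tableau of shape $\lambda$ is a bijection $\Lambda$ from the diagram to $\{1,\ldots,l\}$; it is standard if $\Lambda(a,b)<\Lambda(a+1,b)$ and $\Lambda(a,b)<\Lambda(a,b+1)$ whenever defined. If $\Lambda(a,b)=i$ put $c_i(\Lambda)=b-a$. The column tableau $\Lambda^\circ$ of shape $\lambda$ is the standard tableau with $\Lambda^\circ(a+1,b)=\Lambda^\circ(a,b)+1$ (filled by $1,\ldots,l$ down successive columns from left to right). Put $F_i(x,y)=T_i+\dfrac{q-q^{-1}}{x^{-1}y-1}$. For a standard tableau $\Lambda$ let $F_\Lambda(z_1,\ldots,z_l)=\prod^{\longrightarrow}_{(i,j)}F_{j-i}(q^{2c_i(\Lambda)}z_i,q^{2c_j(\Lambda)}z_j)$, the product over pairs $1\le i<j\le l$ ordered from left to right so that $(i,j)$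 precedes $(i',j')$ if $j<j'$, or $j=j'$ and $i<i'$. Let $\mathcal{Z}_\Lambda\subset\mathbb{C}(q)^{\times l}$ be the subspace of tuples with $z_i=z_j$ whenever $i,j$ are in the same column of $\Lambda$. The restriction of $F_\Lambda(z_1,\ldots,z_l)$ to $\mathcal{Z}_\Lambda$ is regular at $(1,\ldots,1)$; its value there is $F_\Lambda\in H_l$. *)

(* Defs.v *)
From HB Require Import structures.
From mathcomp Require Import all_boot all_order all_algebra.
From mathcomp Require Import generic_quotient ring_quotient fraction complex.
From mathcomp Require Import boolp classical_sets reals.
From mathcomp.multinomials Require Import monalg mpoly.

Set Implicit Arguments.
Unset Strict Implicit.
Unset Printing Implicit Defensive.

Import GRing.Theory.
Local Open Scope ring_scope.
Local Open Scope quotient_scope.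

(* C(q), with the complex numbers realized as R[i]. *)
Definition Cq (R : realType) : fieldType := {fraction {poly R[i]}}.

Definition Cq_q (R : realType) : Cq R := tofrac 'X.

Section Hecke.
Variables (K : fieldType) (q : K) (l : nat).

Local Notation free_alg := {malg K[{fmonom 'I_l.-1}]}.

(* The letter i : 'I_l.-1 stands for the generator T_(i + 1). *)
Definition letter (i : 'I_l.-1) : free_alg := << fmu i >>.

Inductive hecke_relator : free_alg -> Prop :=
| HeckeQuadratic i :
    hecke_relator ((letter i - q%:A) * (letter i + q^-1%:A))
| HeckeBraid (i j : 'I_l.-1) : (j = i.+1 :> nat) ->
    hecke_relator (letter i * letter j * letter i
                   - letter j * letter i * letter j)
| HeckeCommute (i j : 'I_l.-1) : (i.+1 < j)%N || (j.+1 < i)%N ->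
    hecke_relator (letter i * letter j - letter j * letter i).

Inductive hecke_ideal_gen : free_alg -> Prop :=
| HeckeIdealRel x : hecke_relator x -> hecke_ideal_gen x
| HeckeIdeal0 : hecke_ideal_gen 0
| HeckeIdealB x y :
    hecke_ideal_gen x -> hecke_ideal_gen y -> hecke_ideal_gen (x - y)
| HeckeIdealMl a x : hecke_ideal_gen x -> hecke_ideal_gen (a * x)
| HeckeIdealMr a x : hecke_ideal_gen x -> hecke_ideal_gen (x * a).

Definition hecke_ideal : {pred free_alg} := fun x => `[< hecke_ideal_gen x >].

Lemma hecke_ideal_zmod_closed : zmod_closed hecke_ideal.
Proof.
split; first by apply/asboolP; exact: HeckeIdeal0.
by move=> x y /asboolP ? /asboolP ?; apply/asboolP; exact: HeckeIdealB.
Qed.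

HB.instance Definition _ :=
  GRing.isZmodClosed.Build free_alg hecke_ideal hecke_ideal_zmod_closed.

Lemma hecke_idealMl a x : x \in hecke_ideal -> a * x \in hecke_ideal.
Proof. by move=> /asboolP ?; apply/asboolP; exact: HeckeIdealMl. Qed.

Lemma hecke_idealMr a x : x \in hecke_ideal -> x * a \in hecke_ideal.
Proof. by move=> /asboolP ?; apply/asboolP; exact: HeckeIdealMr. Qed.

(* The character T_i |-> q shows that the quotient is not trivial. *)
Definition hecke_char_fmonom (m : {fmonom 'I_l.-1}) : K := q ^+ fdeg m.

Lemma hecke_char_fmonom_morph : mmorphism hecke_char_fmonom.
Proof.
by split=> [m1 m2|]; rewrite /hecke_char_fmonom ?fdegM ?exprD// fdeg1.
Qed.

HB.instance Definition _ :=
  monalg.isMultiplicative.Build _ _ hecke_char_fmonom hecke_char_fmonom_morph.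

(* Stated for an abstract ring: rewriting in the free algebra is slow. *)
Lemma rmorph_braid0 (A : nzRingType) (chi : {rmorphism A -> K}) x y :
  chi x = q -> chi y = q -> chi (x * y * x - y * x * y) = 0.
Proof. by move=> xq yq; rewrite rmorphB !rmorphM xq yq subrr. Qed.

Lemma rmorph_comm0 (A : nzRingType) (chi : {rmorphism A -> K}) x y :
  chi (x * y - y * x) = 0.
Proof. by rewrite rmorphB !rmorphM mulrC subrr. Qed.

Lemma hecke_ideal1 : 1 \notin hecke_ideal.
Proof.
have [chi [chiZ chiT]] : exists chi : {rmorphism free_alg -> K},
    (forall a, chi a%:A = a) /\ (forall i, chi (letter i) = q).
  exists (monalg.mmap idfun hecke_char_fmonom); split=> [a|i] /=.
    by rewrite -mul_malgC mulr1 monalg.mmapC.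
  by rewrite monalg.mmapU/= /hecke_char_fmonom fdegU mul1r.
suff chi0 x : hecke_ideal_gen x -> chi x = 0.
  by apply/negP => /asboolP/chi0/eqP; rewrite rmorph1 oner_eq0.
elim=> {x} [x [i|i j _|i j _]||x y _ x0 _ y0|a x _ x0|a x _ x0].
- by rewrite rmorphM rmorphB chiT chiZ subrr mul0r.
- exact: rmorph_braid0 (chiT i) (chiT j).
- exact: rmorph_comm0.
- exact: rmorph0.
- by rewrite rmorphB x0 y0 subrr.
- by rewrite rmorphM x0 mulr0.
- by rewrite rmorphM x0 mul0r.
Qed.

Definition hecke := {ideal_quot hecke_ideal}.
HB.instance Definition _ := GRing.Zmodule.on hecke.
HB.instance Definition _ := Quotient.on hecke.

Definition hecke_pi (x : free_alg) : hecke := \pi_hecke x.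

Lemma hecke_pi_eq x y : (hecke_pi x == hecke_pi y) = (x - y \in hecke_ideal).
Proof. by rewrite (@Quotient.idealrBE free_alg hecke_ideal). Qed.

Lemma hecke_piP (h : hecke) : {x | h = hecke_pi x}.
Proof. by exists (repr h); rewrite /hecke_pi reprK. Qed.

Lemma hecke_piB : {morph hecke_pi : x y / x - y}.
Proof. by move=> x y; rewrite /hecke_pi pi_addr pi_oppr. Qed.

Lemma hecke_piD : {morph hecke_pi : x y / x + y}.
Proof. by move=> x y; rewrite /hecke_pi pi_addr. Qed.

Definition hecke_one : hecke := hecke_pi 1.
Definition hecke_mul (g h : hecke) : hecke := hecke_pi (repr g * repr h).
Definition hecke_scale (a : K) (h : hecke) : hecke := hecke_pi (a *: repr h).

Lemma hecke_repr x : repr (hecke_pi x) - x \in hecke_ideal.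
Proof. by rewrite -hecke_pi_eq /hecke_pi reprK. Qed.

Lemma hecke_mulE x y : hecke_mul (hecke_pi x) (hecke_pi y) = hecke_pi (x * y).
Proof.
apply/eqP; rewrite hecke_pi_eq.
have -> : repr (hecke_pi x) * repr (hecke_pi y) - x * y
    = (repr (hecke_pi x) - x) * repr (hecke_pi y)
      + x * (repr (hecke_pi y) - y).
  by rewrite mulrBl mulrBr addrA subrK.
by apply: rpredD; [apply: hecke_idealMr|apply: hecke_idealMl]; apply: hecke_repr.
Qed.

Lemma hecke_scaleE a x : hecke_scale a (hecke_pi x) = hecke_pi (a *: x).
Proof.
by apply/eqP; rewrite hecke_pi_eq -scalerBr -mul_malgC hecke_idealMl ?hecke_repr.
Qed.

Lemma hecke_mulA : associative hecke_mul.
Proof.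
move=> f g h; case: (hecke_piP f) (hecke_piP g) (hecke_piP h).
by move=> x -> [y ->] [z ->]; rewrite !hecke_mulE mulrA.
Qed.

Lemma hecke_mul1 : left_id hecke_one hecke_mul.
Proof. by move=> g; case: (hecke_piP g) => x ->; rewrite hecke_mulE mul1r. Qed.

Lemma hecke_mulr1 : right_id hecke_one hecke_mul.
Proof. by move=> g; case: (hecke_piP g) => x ->; rewrite hecke_mulE mulr1. Qed.

Lemma hecke_mulDl : left_distributive hecke_mul +%R.
Proof.
move=> f g h; case: (hecke_piP f) (hecke_piP g) (hecke_piP h).
by move=> x -> [y ->] [z ->]; rewrite -hecke_piD !hecke_mulE mulrDl hecke_piD.
Qed.

Lemma hecke_mulDr : right_distributive hecke_mul +%R.
Proof.
move=> f g h; case: (hecke_piP f) (hecke_piP g) (hecke_piP h).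
by move=> x -> [y ->] [z ->]; rewrite -hecke_piD !hecke_mulE mulrDr hecke_piD.
Qed.

Lemma hecke_one_neq0 : hecke_one != 0.
Proof.
have -> : 0 = hecke_pi 0 by rewrite -[in RHS](subrr 0) hecke_piB subrr.
by rewrite hecke_pi_eq subr0 hecke_ideal1.
Qed.

HB.instance Definition _ := GRing.Zmodule_isNzRing.Build hecke
  hecke_mulA hecke_mul1 hecke_mulr1 hecke_mulDl hecke_mulDr hecke_one_neq0.

Lemma hecke_scaleA a b h :
  hecke_scale a (hecke_scale b h) = hecke_scale (a * b) h.
Proof. by case: (hecke_piP h) => x ->; rewrite !hecke_scaleE scalerA. Qed.

Lemma hecke_scale1 : left_id 1 hecke_scale.
Proof. by move=> h; case: (hecke_piP h) => x ->; rewrite hecke_scaleE scale1r. Qed.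

Lemma hecke_scaleDr : right_distributive hecke_scale +%R.
Proof.
move=> a g h; case: (hecke_piP g) (hecke_piP h) => x -> [y ->].
by rewrite -hecke_piD !hecke_scaleE scalerDr hecke_piD.
Qed.

Lemma hecke_scaleDl h : {morph hecke_scale^~ h : a b / a + b}.
Proof.
move=> a b; case: (hecke_piP h) => x ->.
by rewrite !hecke_scaleE scalerDl hecke_piD.
Qed.

HB.instance Definition _ := GRing.Zmodule_isLmodule.Build K hecke
  hecke_scaleA hecke_scale1 hecke_scaleDr hecke_scaleDl.

Lemma hecke_piM : {morph hecke_pi : x y / x * y}.
Proof. by move=> x y; rewrite -hecke_mulE. Qed.

Lemma hecke_piZ a : {morph hecke_pi : x / a *: x}.
Proof. by move=> x; rewrite -hecke_scaleE. Qed.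

Lemma hecke_scaleAl a (g h : hecke) : a *: (g * h) = (a *: g) * h.
Proof.
case: (hecke_piP g) (hecke_piP h) => x -> [y ->].
by rewrite -hecke_piM -!hecke_piZ -hecke_piM scalerAl.
Qed.

HB.instance Definition _ := GRing.Lmodule_isLalgebra.Build K hecke
  hecke_scaleAl.

Lemma free_alg_scalarC (a : K) (x : free_alg) :
  mkmalgU (mone : {fmonom 'I_l.-1}) a * x
    = x * mkmalgU (mone : {fmonom 'I_l.-1}) a.
Proof.
rewrite malgM_def fgmulUg malgM_def fgmulgU.
by apply: eq_bigr => m _; rewrite mulrC mul1m mulm1.
Qed.

Lemma hecke_scaleAr a (g h : hecke) : a *: (g * h) = g * (a *: h).
Proof.
case: (hecke_piP g) (hecke_piP h) => x -> [y ->].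
rewrite -hecke_piM -!hecke_piZ -hecke_piM.
by rewrite -!mul_malgC !mulrA free_alg_scalarC.
Qed.

HB.instance Definition _ := GRing.Lalgebra_isAlgebra.Build K hecke
  hecke_scaleAr.

(* T_k for 1 <= k <= l - 1; the other values of k are irrelevant. *)
Definition hecke_T (k : nat) : hecke :=
  if insub k.-1 is Some i then hecke_pi (letter i) else 0.

End Hecke.

Section Tableaux.
Local Open Scope nat_scope.

Definition is_partition_of (lam : seq nat) (l : nat) : bool :=
  [&& sorted geq lam, 0 \notin lam & sumn lam == l].

(* The boxes (a, b) with 1 <= a and 1 <= b <= lambda_a. *)
Definition diagram (lam : seq nat) : seq (nat * nat) :=
  [seq (a, b) | a <- iota 1 (size lam), b <- iota 1 (nth 0 lam a.-1)].

(* Only the values of a tableau on the boxes of the diagram are relevant. *)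
Definition tableau := nat * nat -> nat.

Definition is_tableau (lam : seq nat) (L : tableau) : Prop :=
  perm_eq [seq L x | x <- diagram lam] (iota 1 (sumn lam)).

Definition is_standard (lam : seq nat) (L : tableau) : Prop :=
  is_tableau lam L /\
  forall a b, (a, b) \in diagram lam ->
    ((a.+1, b) \in diagram lam -> L (a, b) < L (a.+1, b)) /\
    ((a, b.+1) \in diagram lam -> L (a, b) < L (a, b.+1)).

Definition is_column_tableau (lam : seq nat) (L : tableau) : Prop :=
  is_standard lam L /\
  forall a b, (a, b) \in diagram lam -> (a.+1, b) \in diagram lam ->
    L (a.+1, b) = (L (a, b)).+1.

Definition box_of (lam : seq nat) (L : tableau) (i : nat) : nat * nat :=
  nth (0, 0) (diagram lam) (index i [seq L x | x <- diagram lam]).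

Definition content (lam : seq nat) (L : tableau) (i : nat) : int :=
  ((box_of lam L i).2%:Z - (box_of lam L i).1%:Z)%R.

End Tableaux.

Section Fusion.
Variables (K : fieldType) (q : K) (l : nat) (lam : seq nat) (L : tableau).

Definition hecke_F (k : nat) (x y : K) : hecke q l :=
  hecke_T q l k + ((q - q^-1) / (x^-1 * y - 1))%:A.

(* The index i : 'I_l stands for the number i + 1 of the text. *)
Definition fusion_arg (z : 'I_l -> K) (i : 'I_l) : K :=
  q ^ (2 * content lam L i.+1) * z i.

Definition fusion_fun (z : 'I_l -> K) : hecke q l :=
  \prod_(j < l) \prod_(i < l | (i < j)%N)
    hecke_F (j - i) (fusion_arg z i) (fusion_arg z j).

(* The points where no denominator of [fusion_fun] vanishes. *)
Definition fusion_dom : set ('I_l -> K) :=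
  [set z | (forall i, z i != 0) /\
           forall i j : 'I_l, (i < j)%N -> fusion_arg z i != fusion_arg z j].

Definition same_column_space : set ('I_l -> K) :=
  [set z | forall i j : 'I_l,
     (box_of lam L i.+1).2 = (box_of lam L j.+1).2 -> z i = z j].

End Fusion.

(* Let f be a function with values in a K-vector space M, given at the points
   of D by a formula rational in the coordinates. Its restriction to Z is
   regular at p with value v: on Z it is a combination of vectors of M whose
   coefficients are fractions with denominators that do not vanish at p. *)
Definition regular_value (K : fieldType) (M : lmodType K) (l : nat)
    (Z D : set ('I_l -> K)) (f : ('I_l -> K) -> M) (p : 'I_l -> K) (v : M) :
    Prop :=
  exists (n : nat) (P Q : 'I_n -> mpoly l K) (w : 'I_n -> M),
    [/\ forall k, (Q k).@[p] != 0,
        forall z, Z z -> D z -> (forall k, (Q k).@[z] != 0) ->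
          f z = \sum_(k < n) ((P k).@[z] / (Q k).@[z]) *: w k &
        v = \sum_(k < n) ((P k).@[p] / (Q k).@[p]) *: w k].

(* The value at (1, ..., 1); it is unique because the points considered in
   [regular_value] are Zariski dense in Z. The default 0 of [xget] would only
   be taken if the restriction were not regular there. *)
Definition fusion_elt (K : fieldType) (q : K) (l : nat) (lam : seq nat)
    (L : tableau) : hecke q l :=
  xget 0 [set v | regular_value (same_column_space lam L)
                    (fusion_dom q lam L) (fusion_fun q lam L) (fun=> 1) v].

Definition principal_left_ideal (A : pzRingType) (x : A) : {pred A^o} :=
  fun y => `[< exists a : A, y = a * x >].

(* V is a simple A-module for the action inherited from M. *)
Definition irreducible_submodule (A : pzRingType) (M : lmodType A)
    (V : {pred M}) : Prop :=
  [/\ submod_closed V, exists2 v, v \in V & v != 0 &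
      forall W : {pred M}, submod_closed W -> {subset W <= V} ->
        W =i pred1 0 \/ W =i V].

(* Main.v *)
Require Import Defs.
From HB Require Import structures.
From mathcomp Require Import all_boot all_order all_algebra all_fingroup.
From mathcomp Require Import generic_quotient fraction complex.
From mathcomp Require Import boolp classical_sets reals.
From mathcomp Require Import ring zify.
From mathcomp.finmap Require finmap.
From mathcomp.multinomials Require monalg mpoly.

(** The proof has two halves.

    _Any weight vector generates a simple left ideal._ Let X_1 = 1 and
    X_(k+1) = T_k X_k T_k be the Jucys-Murphy elements, and let F <> 0 satisfy
    X_k F = q^(2 c_k) F for integers c_k. Complex conjugation extends to an
    involution of C(q) that fixes q, and the basis T_w, declared orthonormal,
    defines a Hermitian form on H_l for which the T_i, hence the X_k, are
    self-adjoint, and which is anisotropic because a sum of terms conj(f) f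
    over C(q) vanishes only trivially. This form replaces semisimplicity: if
    the weights at places i and i+1 of a weight vector v have contents that
    differ by one, then the intertwiner T_i + (q - q^-1)/(x^-1 y - 1) sends v to
    a vector that is orthogonal both to v and to itself, so T_i v is a multiple
    of v; equal adjacent contents would be incompatible with the Hermitian
    form. Applying intertwiners along reduced words to F therefore
    gives vectors v_w, indexed by the arrangements w in which only labels with
    contents at distance at least two are inverted. By the Yang-Baxter
    equation v_w does not depend on the word ([diamond]), the v_w span H_l F
    ([left_ideal_span]), and different w have different weights
    ([weights_separate]). Projecting onto a weight, every nonzero submodule
    contains some v_w, and intertwiners with contents at distance at least
    two are invertible, so it contains F ([weight_vector_minimal]).

    _The fusion element is a nonzero weight vector._ Regularity on the
    subspace: a pole in the factor (i, j) occurs when i and j lie on the same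
    diagonal; then i + 1 lies below i, the product of the preceding columns is
    killed on the right by T_k + q^-1 for a suitable k, and modulo this
    relation the product of the factors (i, j) and (i + 1, j) is regular
    ([merge_factors], [block_regular]). For the eigenvalue of X_(m+1) there are
    two cases ([left_weights]). If m + 1 is not at the top of its column, the
    product is killed on the left by T_m + q^-1 and the eigenvalue of X_m is
    transported. If it is at the top, the last block of factors has no pole,
    and the formula of [jm_interpolation] shows that X_(m+1) - u annihilates
    the result, as the content of m + 1 exceeds that of an earlier label by
    one. That formula needs the weights of the previous product from the
    right; they are its weights from the left in the opposite algebra with
    the generators numbered backwards, where by Yang-Baxter the fusion product
    is the same element ([fusion_prod_converse]). Finally F <> 0, because the
    coefficient of F at the longest element is the constant 1
    ([fusion_prod_top]). *)

Set Implicit Arguments.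
Unset Strict Implicit.
Unset Printing Implicit Defensive.

Import Order.TTheory GRing.Theory.
Local Open Scope ring_scope.

(** * Linear identities in modules *)

(** Two linear combinations of the same vectors are equal as soon as their
    coefficients agree, so a noncommutative identity, once expanded into
    words, reduces to identities between scalars. *)
Inductive lin_expr (K : Type) : Type :=
| LinVar of nat
| LinZero
| LinAdd of lin_expr K & lin_expr K
| LinOpp of lin_expr K
| LinScale of K & lin_expr K.

Section LinExpr.
Variables (K : pzRingType) (M : lmodType K).

Fixpoint lin_eval (env : seq M) (e : lin_expr K) : M :=
  match e with
  | LinVar i => env`_i
  | LinZero => 0
  | LinAdd e1 e2 => lin_eval env e1 + lin_eval env e2
  | LinOpp e1 => - lin_eval env e1
  | LinScale c e1 => c *: lin_eval env e1
  end.

Fixpoint lin_coef (e : lin_expr K) (i : nat) : K :=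
  match e with
  | LinVar j => if j == i then 1 else 0
  | LinZero => 0
  | LinAdd e1 e2 => lin_coef e1 i + lin_coef e2 i
  | LinOpp e1 => - lin_coef e1 i
  | LinScale c e1 => c * lin_coef e1 i
  end.

Lemma lin_evalE (env : seq M) e :
  lin_eval env e = \sum_(i < size env) lin_coef e i *: env`_i.
Proof.
elim: e => [j||e1 IH1 e2 IH2|e1 IH1|c e1 IH1] /=.
- case: (ltnP j (size env)) => [lt_j|le_j].
    rewrite (bigD1 (Ordinal lt_j)) //= eqxx scale1r big1 ?addr0// => i ne_i.
    rewrite ifN ?scale0r//; apply: contra ne_i => /eqP ji.
    by apply/eqP/val_inj; rewrite /= ji.
  rewrite nth_default// big1// => i _; rewrite ifN ?scale0r//.
  by rewrite gtn_eqF// (leq_trans (ltn_ord i)).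
- by rewrite big1// => i _; rewrite scale0r.
- by rewrite IH1 IH2 -big_split; apply: eq_bigr => i _; rewrite scalerDl.
- by rewrite IH1 -sumrN; apply: eq_bigr => i _; rewrite scaleNr.
- by rewrite IH1 scaler_sumr; apply: eq_bigr => i _; rewrite scalerA.
Qed.

Fixpoint lin_same (e1 e2 : lin_expr K) (n : nat) : Prop :=
  if n is n'.+1 then lin_coef e1 n' = lin_coef e2 n' /\ lin_same e1 e2 n'
  else True.

Lemma lin_evalP (env : seq M) e1 e2 :
  lin_same e1 e2 (size env) -> lin_eval env e1 = lin_eval env e2.
Proof.
move=> same; rewrite !lin_evalE; apply: eq_bigr => -[i /= lt_i] _.
congr (_ *: _); elim: (size env) lt_i same => // n IH.
by rewrite ltnS leq_eqVlt => /predU1P[->|/IH le_i] /= [].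
Qed.
End LinExpr.

Ltac lin_mem x env :=
  match env with
  | ?y :: ?env' => first [unify x y | lin_mem x env']
  end.
Ltac lin_vars e env :=
  match e with
  | (?a + ?b)%R => let env1 := lin_vars a env in lin_vars b env1
  | (- ?a)%R => lin_vars a env
  | (?c *: ?a)%R => lin_vars a env
  | 0%R => env
  | ?x => match constr:(Set) with
          | _ => let _ := match constr:(Set) with _ => lin_mem x env end in env
          | _ => constr:(x :: env)
          end
  end.
Ltac lin_idx x env :=
  match env with
  | ?y :: ?env' =>
    match constr:(Set) with
    | _ => let _ := match constr:(Set) with _ => unify x y end in constr:(O)
    | _ => let i := lin_idx x env' in constr:(S i)
    end
  end.
Ltac lin_reify K e env :=
  match e with
  | (?a + ?b)%R => let a' := lin_reify K a env in let b' := lin_reify K b env in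
                 constr:(LinAdd a' b')
  | (- ?a)%R => let a' := lin_reify K a env in constr:(LinOpp a')
  | (?c *: ?a)%R => let a' := lin_reify K a env in constr:(LinScale c a')
  | 0%R => constr:(LinZero K)
  | ?x => let i := lin_idx x env in constr:(LinVar K i)
  end.
(** Both sides are read as combinations over a common list of vectors; one
    goal per vector remains, between its two coefficients. *)
Ltac lin_comb K :=
  match goal with
  | |- @eq ?M ?L ?R =>
    let env0 := constr:(@nil M) in
    let env1 := lin_vars L env0 in
    let env := lin_vars R env1 in
    let eL := lin_reify K L env in
    let eR := lin_reify K R env in
    apply: (@lin_evalP K _ env eL eR); repeat split;
      cbn [lin_coef eq_op Equality.sort]; rewrite /=
  end.

(** * Fusion products and the Yang-Baxter equation *)

Section Family.
Variables (K : fieldType) (q : K).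
Notation h := (q - q^-1).

(** The relations only involve the first n entries of t: initial segments,
    shifts and reversals of a family of generators are again of this kind. *)
Definition hecke_family (A : algType K) (n : nat) (t : nat -> A) : Prop :=
  [/\ forall k, (k < n)%N -> t k * t k = 1 + h *: t k,
      forall k, (k.+1 < n)%N -> t k * t k.+1 * t k = t k.+1 * t k * t k.+1 &
      forall i j, (i.+1 < j)%N -> (j < n)%N -> t i * t j = t j * t i].

Definition phi (A : algType K) (t : nat -> A) (k : nat) (x y : K) : A :=
  t k + (h / (x^-1 * y - 1))%:A.

Lemma hecke_family_shift (A : algType K) n (t : nat -> A) :
  hecke_family n t -> hecke_family n.-1 (fun k => t k.+1).
Proof.
case=> quad braid far; split=> [k ?|k ?|i j ? ?];
  [apply: quad|apply: braid|apply: far]; lia.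
Qed.

Lemma hecke_family_le (A : algType K) m n (t : nat -> A) :
  (m <= n)%N -> hecke_family n t -> hecke_family m t.
Proof.
move=> le [quad braid far]; split=> [k ?|k ?|i j ? ?];
  [apply: quad|apply: braid|apply: far]; lia.
Qed.

Variable A : algType K.
Implicit Types (t : nat -> A) (x y z u : K) (ys : seq K).

(** Expands a product of terms t + a%:A into words with scalar coefficients
    in front. *)
Definition algE := (mulrDl, mulrDr, mulrBl, mulrBr, =^~ scalerAl, =^~ scalerAr,
  mul1r, mulr1, mulrA, scalerA, scalerDr, scalerBr, mulNr, mulrN, scalerN).

Lemma phi_coef x y : x != 0 -> y - x != 0 ->
  h / (x^-1 * y - 1) = h * x / (y - x).
Proof.
move=> x0 yx0; have -> : x^-1 * y - 1 = (y - x) / x by field.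
by move: h => c; field; rewrite x0 yx0.
Qed.

(** The two sides differ by the multiple b * c0 + a * b + b * c - a * c of s
    - s', which is zero by hypothesis. *)
Lemma braid_coef (c0 a b c : K) (s s' : A) :
  s * s = 1 + c0 *: s -> s' * s' = 1 + c0 *: s' -> s * s' * s = s' * s * s' ->
  b * (c0 + a + c) = a * c ->
  (s + a%:A) * (s' + b%:A) * (s + c%:A) = (s' + c%:A) * (s + b%:A) *
    (s' + a%:A).
Proof.
move=> ss s's' ss's abc; rewrite !algE ss's ss s's'.
rewrite !algE; lin_comb K; ring: (esym abc).
Qed.

Lemma yang_baxter n t k x y z : hecke_family n t -> (k.+1 < n)%N ->
  [/\ x != 0, y != 0 & z != 0] -> [/\ x != y, x != z & y != z] ->
  phi t k x y * phi t k.+1 x z * phi t k y z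
    = phi t k.+1 y z * phi t k x z * phi t k.+1 x y.
Proof.
case=> quad braid _ lt_k [x0 y0 z0] [xy xz yz].
have yx0 : y - x != 0 by rewrite subr_eq0 eq_sym.
have zx0 : z - x != 0 by rewrite subr_eq0 eq_sym.
have zy0 : z - y != 0 by rewrite subr_eq0 eq_sym.
rewrite /phi !phi_coef//.
apply: (@braid_coef h); [by apply: quad; lia|exact: quad|exact: braid|].
by move: h => c; field; rewrite yx0 zx0 zy0.
Qed.

(** The factors (i, j) of the fusion product for a fixed j, where u is the
    argument of j and ys lists those of the i < j. *)
Fixpoint block t ys u : A :=
  if ys is y :: ys' then phi t (size ys') y u * block t ys' u else 1.

Definition fusion_prod t ys : A := \prod_(j < size ys) block t (take j ys)
  ys`_j.

Lemma fusion_prod_rcons t ys u : fusion_prod t (rcons ys u) = fusion_prod t ys *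
  block t ys u.
Proof.
rewrite /fusion_prod size_rcons big_ord_recr /= nth_rcons ltnn eqxx.
rewrite -cats1 take_size_cat//; congr (_ * _); apply: eq_bigr => i _ /=.
by rewrite takel_cat 1?ltnW// cats1 nth_rcons ltn_ord.
Qed.

Lemma comm_phi t k x y (a : A) : GRing.comm a (t k) ->
  GRing.comm a (phi t k x y).
Proof. by move=> at_k; rewrite /GRing.comm /phi !algE at_k. Qed.

Lemma comm_block t ys u (a : A) :
  (forall k, (k < size ys)%N -> GRing.comm a (t k)) ->
    GRing.comm a (block t ys u).
Proof.
elim: ys => [_|y ys IH comm_at] /=; first exact: commr1.
apply: commrM; first by apply: comm_phi; apply: comm_at; exact: ltnSn.
by apply: IH => k lt_k; apply: comm_at; rewrite /= ltnW.
Qed.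

Lemma comm_fusion_prod t ys (a : A) :
  (forall k, (k.+1 < size ys)%N -> GRing.comm a (t k)) ->
    GRing.comm a (fusion_prod t ys).
Proof.
move=> comm_at; apply: commr_prod => j _; apply: comm_block => k.
by rewrite size_take ltn_ord => ?; apply: comm_at; have := ltn_ord j; lia.
Qed.

Definition generic ys := uniq ys && (0 \notin ys).

Lemma generic_rcons ys u : generic (rcons ys u) =
  [&& u != 0, u \notin ys & generic ys].
Proof.
rewrite /generic rcons_uniq mem_rcons inE negb_or eq_sym.
by case: (u != 0); case: (u \in ys); case: (uniq ys).
Qed.

Lemma generic_cons u ys : generic (u :: ys) =
  [&& u != 0, u \notin ys & generic ys].
Proof.
rewrite /generic /= inE negb_or eq_sym.
by case: (u != 0); case: (u \in ys); case: (uniq ys).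
Qed.

Lemma hecke_far n t i j : hecke_family n t -> (i < n)%N -> (j < n)%N ->
  (i.+1 < j)%N || (j.+1 < i)%N -> GRing.comm (t i) (t j).
Proof.
by case=> _ _ far lt_i lt_j /orP[] lt; [apply: far|apply/commr_sym; apply: far].
Qed.

(** Exchanges the letters v and u: Yang-Baxter moves the factor of (v, u)
    from the right end to the left one, past one letter y at a time. *)
Lemma block_exchange n t ys v u : hecke_family n t -> (size ys < n)%N ->
  generic (u :: v :: ys) ->
  block t ys v * block t (rcons ys v) u
    = phi t (size ys) v u * block t ys u * block (fun k => t k.+1) ys v.
Proof.
move=> tH lt_n; rewrite !generic_cons !inE !negb_or.
elim: ys lt_n => [|y ys IH] lt_n.
  by move=> _; rewrite /= !mulr1 mul1r.
rewrite generic_cons !inE !negb_or /= => /and3P[u0 /and3P[uv uy uys]].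
case/and3P=> v0 /andP[vy vys] /and3P[y0 yys gys].
rewrite size_rcons; set s := size ys.
have comm_s (a : nat) w : (s < a < n)%N -> GRing.comm (t a) (block t ys w).
  by move=> ?; apply: comm_block => k lt_k; apply: (hecke_far tH); lia.
have commB w w' : phi t s.+1 y w * block t ys w' = block t ys w' *
  phi t s.+1 y w.
  by apply/commr_sym/comm_phi/commr_sym/comm_s; rewrite ltnSn.
rewrite -[phi (fun k => t k.+1) s y v]/(phi t s.+1 y v).
rewrite -!mulrA [block t ys v * _]mulrA -commB -!mulrA IH; first last.
- by rewrite u0 v0 uv uys vys gys.
- exact: ltnW.
rewrite [block t ys u * (phi _ _ _ _ * _)]mulrA -commB !mulrA.
by rewrite (@yang_baxter n)//; split=> //; rewrite eq_sym.
Qed.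

(** Each factor of the fusion product swaps two neighbouring letters of the
    block by Yang-Baxter; after all of them the block is reversed, and the
    indices of the fusion product have moved up by one. *)
Lemma fusion_prod_block n t ys u : hecke_family n t -> (size ys <= n)%N ->
  generic (rcons ys u) ->
  fusion_prod t ys * block t ys u = block t (rev ys) u *
    fusion_prod (fun k => t k.+1) ys.
Proof.
move=> tH; elim/last_ind: ys => [|ys v IH].
  by rewrite /fusion_prod !big_ord0 /= mul1r.
rewrite size_rcons => lt_n gen.
have gen' : generic (rcons ys u).
  move: gen; rewrite !generic_rcons mem_rcons inE negb_or.
  by case/and3P=> -> /andP[_ ->] /and3P[].
rewrite !fusion_prod_rcons -mulrA (@block_exchange n)//; last first.
  by move: gen; rewrite !generic_cons !generic_rcons mem_rcons inE.
rewrite rev_rcons /= size_rev -[RHS]mulrA [X in _ = _ * X]mulrA -IH//;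
  last exact: ltnW.
rewrite !mulrA; do 2!congr (_ * _); apply/commr_sym/commr_sym/comm_phi.
apply/commr_sym/comm_fusion_prod => k lt_k; apply: (hecke_far tH); lia.
Qed.

Lemma hecke_eigen n t k : q != 0 -> hecke_family n t -> (k < n)%N ->
  (t k - q%:A) * (t k + q^-1%:A) = 0.
Proof.
move=> q0 [quad _ _] lt_k; rewrite !algE quad//.
lin_comb K; by field.
Qed.

Lemma phi_qm2 t k x : q != 0 -> q ^+ 2 != 1 -> x != 0 ->
  phi t k x (q ^- 2 * x) = t k - q%:A.
Proof.
move=> q0 q2 x0; rewrite /phi -scaleNr; congr (_ + _ *: _).
have q21 : q ^+ 2 - 1 != 0 by rewrite subr_eq0.
have -> : x^-1 * (q ^- 2 * x) - 1 = (1 - q ^+ 2) / q ^+ 2.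
  by field; rewrite q0 x0.
field; rewrite q0 /= -oppr_eq0 opprB.
by have -> : q ^+ 2 - 1 = q^+2 - 1 by ring.
Qed.

Lemma block_cat t ys1 ys2 u : block t (ys1 ++ ys2) u
  = block (fun k => t (k + size ys2)%N) ys1 u * block t ys2 u.
Proof.
elim: ys1 => [|y ys1 IH] /=; first by rewrite mul1r.
by rewrite IH size_cat mulrA.
Qed.

Hypothesis q0 : q != 0.
Hypothesis q_gen : forall n, (0 < n)%N -> q ^+ n != 1.

Lemma q_sq1 : q ^+ 2 != 1. Proof. exact: q_gen. Qed.
Lemma q_plus0 : q + q^-1 != 0.
Proof.
apply/eqP => qq; have /negP[] := q_gen (isT : 0 < 4)%N.
have -> : q ^+ 4 = 1 + q * (q + q^-1) * (q ^+ 2 - 1) by field.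
by rewrite qq mulr0 mul0r addr0.
Qed.

(** Yang-Baxter carries the factor of (i, i + 1), which is T - q for these
    arguments, to the right end of the product, where it is killed by T +
    q^-1. In the induction, a new letter u is passed by writing E as a
    multiple of E * (T - q). *)
Lemma fusion_prod_mulr_eq0 n t ys i : hecke_family n t ->
  generic ys -> (size ys <= n.+1)%N -> (i.+1 < size ys)%N ->
  ys`_i.+1 = q ^- 2 * ys`_i ->
  fusion_prod t ys * (t (size ys - i.+2)%N + q^-1%:A) = 0.
Proof.
move=> tH; elim/last_ind: ys => [|ys u IH] //.
rewrite size_rcons generic_rcons !ltnS => /and3P[u0 uys gys] le_n lt_i.
rewrite !nth_rcons lt_i fusion_prod_rcons.
case: (ltngtP i.+1 (size ys)) lt_i => [lt_i|? ?|i_eq] _; [|lia|]; last first.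
  have -> : ((size ys).+1 - i.+2 = 0)%N by lia.
  case/lastP: ys i_eq gys u0 uys {IH} le_n => [//|ys y];
    rewrite size_rcons => -[->].
  rewrite nth_rcons ltnn eqxx generic_rcons => /and3P[y0 _ _] u0 yu le_n ->.
  rewrite -cats1 block_cat /= mulr1 phi_qm2 ?q_sq1//.
  by rewrite -!mulrA (hecke_eigen q0 tH) ?mulr0//; lia.
move=> yi; have {IH} := IH gys (leqW le_n) lt_i yi.
set x := ys`_i in yi *; set x' := ys`_i.+1 in yi *.
have ysE : ys = take i ys ++ x :: x' :: drop i.+2 ys.
  by rewrite -!drop_nth ?cat_take_drop//; exact: ltnW.
have xi : x \in ys by apply: mem_nth; exact: ltnW.
have x'i : x' \in ys by apply: mem_nth.
have xx' : x != x'.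
  case/andP: gys => uys' _; rewrite /x /x' nth_uniq //;
    first by rewrite ltn_eqF.
  exact: ltnW.
set L2 := drop i.+2 ys in ysE *; set L1 := take i ys in ysE *.
have sL1 : size L1 = i by rewrite size_takel//; lia.
have szE : size ys = (i + (size L2).+2)%N by rewrite {1}ysE size_cat sL1.
have -> : (size ys - i.+2 = size L2)%N by lia.
have -> : ((size ys).+1 - i.+2 = (size L2).+1)%N by lia.
move=> eE; set r := size L2 in szE eE *.
rewrite [in block t ys u]ysE block_cat /= -/r.
set M1 := block _ L1 u; set M2 := block t L2 u.
have xNq : phi t r x x' = t r - q%:A.
  rewrite yi phi_qm2 ?q_sq1//; apply/eqP => x0.
  by case/andP: gys => _; rewrite -x0 xi.
have M1r : GRing.comm (t r) M1.
  by apply: comm_block => k lt_k; apply: (hecke_far tH); lia.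
have M2r : GRing.comm (t r.+1) M2.
  by apply: comm_block => k lt_k; apply: (hecke_far tH); lia.
have M2r' : GRing.comm M2 (t r.+1 + q^-1%:A).
  by rewrite /GRing.comm !algE M2r.
set E := fusion_prod t ys * M1.
have E0 : E * (t r + q^-1%:A) = 0.
  have -> : E * (t r + q^-1%:A) = fusion_prod t ys * (t r + q^-1%:A) * M1.
    by rewrite !algE -(mulrA _ (t r)) M1r mulrA.
  by rewrite eE mul0r.
have EE : E = - (q + q^-1)^-1 *: (E * phi t r x x').
  rewrite xNq; have -> : t r - q%:A = (t r + q^-1%:A) - (q + q^-1)%:A.
    by rewrite scalerDl; set a := _ *: 1; set b := _ *: 1; lin_comb K; ring.
  rewrite mulrBr E0 sub0r scaleNr scalerN opprK -scalerAr mulr1 scalerA.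
  by rewrite mulVf ?q_plus0// scale1r.
have {E0} : E * (phi t r.+1 x u * phi t r x' u) * (t r.+1 + q^-1%:A) = 0.
  rewrite EE -!scalerAl -(mulrA E) (mulrA (phi t r x x')).
  rewrite (@yang_baxter n)//; last 3 first.
  - by lia.
  - case/andP: gys => _ ysN0; split=> //; first by apply: contraNneq ysN0 => <-.
    by apply: contraNneq ysN0 => <-.
  - by split=> //; apply: contraNneq uys => <-.
  have -> : phi t r.+1 x x' = t r.+1 - q%:A.
    by move: xNq; rewrite /phi => /addrI ->.
  by rewrite -!mulrA (hecke_eigen q0 tH) ?mulr0 ?scaler0//; lia.
by rewrite -!mulrA M2r' !mulrA => ->; rewrite mul0r.
Qed.
End Family.

(** * Jucys-Murphy elements *)

Section JM.
Variables (K : fieldType) (q : K).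
Notation h := (q - q^-1).
Variable A : algType K.
Implicit Types (t s f : nat -> A) (x y z u : K) (ys : seq K).

Fixpoint jm t k : A := if k is k'.+1 then t k' * jm t k' * t k' else 1.

Fixpoint inc_prod f k : A := if k is k'.+1 then inc_prod f k' * f k' else 1.
Fixpoint dec_prod f k : A := if k is k'.+1 then f k' * dec_prod f k' else 1.

Lemma inc_prod_recl f k : inc_prod f k.+1 = f 0%N * inc_prod (fun i => f i.+1)
  k.
Proof.
elim: k => [|k IH]; first by rewrite /= mul1r mulr1.
by rewrite [LHS]/= -/(inc_prod f k.+1) IH -mulrA.
Qed.

Lemma eq_inc_prod f g k : (forall i, (i < k)%N -> f i = g i) ->
  inc_prod f k = inc_prod g k.
Proof.
by elim: k => //= k IH fg; rewrite IH ?fg// => i ?; apply: fg; apply: ltnW.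
Qed.

Lemma eq_dec_prod f g k : (forall i, (i < k)%N -> f i = g i) ->
  dec_prod f k = dec_prod g k.
Proof.
by elim: k => //= k IH fg; rewrite IH ?fg// => i ?; apply: fg; apply: ltnW.
Qed.

Lemma dec_prod_rev f k : dec_prod f k = inc_prod (fun i => f (k - i.+1)%N) k.
Proof.
elim: k => //= k IH; rewrite -/(inc_prod _ k.+1) inc_prod_recl subn1 /=;
  congr (_ * _).
by rewrite IH; apply: eq_inc_prod => i _; rewrite subSS.
Qed.

Lemma inc_prod_rev f k : inc_prod f k = dec_prod (fun i => f (k - i.+1)%N) k.
Proof.
rewrite dec_prod_rev; apply: eq_inc_prod => i lt_i; congr f; lia.
Qed.

Lemma jmE t k : jm t k = dec_prod t k * inc_prod t k.
Proof. by elim: k => /= [|k ->]; rewrite ?mulr1// !mulrA. Qed.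

Lemma comm_inc_prod f k (a : A) :
  (forall i, (i < k)%N -> GRing.comm a (f i)) -> GRing.comm a (inc_prod f k).
Proof.
elim: k => [_|k IH af] /=; first exact: commr1.
by apply: commrM; [apply: IH => i ?; apply: af; apply: ltnW|exact: af].
Qed.

Lemma comm_dec_prod f k (a : A) :
  (forall i, (i < k)%N -> GRing.comm a (f i)) -> GRing.comm a (dec_prod f k).
Proof.
elim: k => [_|k IH af] /=; first exact: commr1.
by apply: commrM; [exact: af|apply: IH => i ?; apply: af; apply: ltnW].
Qed.

Lemma comm_jm t k (a : A) :
  (forall i, (i < k)%N -> GRing.comm a (t i)) -> GRing.comm a (jm t k).
Proof. by move=> comm_at; rewrite jmE; apply: commrM;
  [exact: comm_dec_prod|exact: comm_inc_prod]. Qed.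

Lemma block_inc_prod t ys u :
  block q t ys u = inc_prod (fun i => phi q t (size ys - i.+1)%N ys`_i u)
    (size ys).
Proof.
elim: ys => //= y ys IH; rewrite -/(inc_prod _ (size ys).+1) inc_prod_recl subn1
  /=.
by rewrite IH; congr (_ * _); apply: eq_inc_prod => i _; rewrite subSS.
Qed.

Lemma hecke_inv n t k : hecke_family q n t -> (k < n)%N ->
  (t k - h%:A) * t k = 1 /\ t k * (t k - h%:A) = 1.
Proof.
move=> [quad _ _] lt_k; split; rewrite (mulrBl, mulrBr) quad//.
  by rewrite -scalerAl mul1r addrK.
by rewrite -scalerAr mulr1 addrK.
Qed.

Lemma inc_dec_prod_inv n t k : hecke_family q n t -> (k <= n)%N ->
  inc_prod t k * dec_prod (fun i => t i - h%:A) k = 1.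
Proof.
move=> tH; elim: k => [|k IH] le_k /=; first by rewrite mulr1.
rewrite mulrA -(mulrA _ (t k)); have [_ ->] := hecke_inv tH le_k.
by rewrite mulr1 IH// ltnW.
Qed.

Lemma right_weight_dec_prod n t k (e : A) x : hecke_family q n t ->
  (k <= n)%N ->
  e * jm t k = x *: e ->
  e * dec_prod t k = x *: (e * dec_prod (fun i => t i - h%:A) k).
Proof.
move=> tH le_k; rewrite jmE mulrA => ex.
by rewrite scalerAl -ex -(mulrA _ (inc_prod t k)) (inc_dec_prod_inv tH)// mulr1.
Qed.

Section Top.
Variables (x : nat -> K) (u : K).
Let a k := h * x k / (u - x k).
Let b k := h * u / (u - x k).

(** The key identity. Its right-hand side makes sense for a vector e whose
    weight for jm t k is arbitrary; this allows the induction on k to be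
    applied to e * t k, which keeps the weights for j < k, as well as to e,
    without any genericity of the weights. *)
Lemma dec_prod_interpolation n t k (e : A) : hecke_family q n t -> (k <= n)%N ->
  (forall j, (j < k)%N -> u != x j) ->
  (forall j, (j < k)%N -> e * jm t j = x j *: e) ->
  (u - 1) *: (e * dec_prod (fun i => t i - (b i)%:A) k)
    = u *: (e * dec_prod (fun i => t i - h%:A) k) - e * dec_prod t k.
Proof.
move=> tH; elim: k e => [|k IH] e le_k ux ex /=.
  by rewrite !mulr1 scalerBl scale1r.
have IHe := IH e (ltnW le_k) (fun j lt => ux j (ltnW lt)) (fun j lt =>
  ex j (ltnW lt)).
have {}IH : (u - 1) *: (e * t k * dec_prod (fun i => t i - (b i)%:A) k)
    = u *: (e * t k * dec_prod (fun i => t i - h%:A) k) - e * t k *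
      dec_prod t k.
  apply: IH => [|j lt_j|j lt_j]; [exact: ltnW|by apply: ux; exact: ltnW|].
  rewrite -mulrA (@comm_jm t j (t k)).
    by rewrite mulrA ex 1?ltnW// scalerAl.
  by move=> i lt_i; apply: (hecke_far tH); lia.
have eU := right_weight_dec_prod tH (ltnW le_k) (ex k (ltnSn k)).
rewrite !mulrA !mulrBr !mulrBl -!scalerAr !mulr1 -!scalerAl.
set m1 := e * t k * dec_prod (fun i => t i - (b i)%:A) k in IH *.
set m2 := e * dec_prod (fun i => t i - (b i)%:A) k in IHe *.
have -> : (u - 1) *: (m1 - b k *: m2) = (u - 1) *: m1 - b k *: ((u - 1) *: m2).
  by lin_comb K; ring.
rewrite IH IHe eU; have uk : u - x k != 0 by rewrite subr_eq0 ux.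
rewrite /b; move: h => c; lin_comb K; by field.
Qed.

Lemma inc_prod_shift n s k i : hecke_family q n s -> (k <= n)%N ->
  (i.+1 < k)%N ->
  inc_prod s k * s i = s i.+1 * inc_prod s k.
Proof.
move=> sH; elim: k => // k IH lt_k; rewrite ltnS leq_eqVlt =>
  /predU1P[k_eq|lt_i] /=.
  case: k k_eq lt_k {IH} => // k [<-] lt_k /=.
  case: sH => [quad braid far]; rewrite -!mulrA [s i * (s i.+1 * _)]mulrA
    braid//.
  rewrite !mulrA; do 2!congr (_ * _).
  by apply/commr_sym/comm_inc_prod => j lt_j; apply/commr_sym; apply: far => //.
rewrite mulrA -IH//; last exact: ltnW.
rewrite -!mulrA; congr (_ * _); apply: (hecke_far sH); lia.
Qed.

Lemma inc_dec_prod_shift n s k m (c : nat -> K) : hecke_family q n s ->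
  (k <= n)%N ->
  (m < k)%N ->
  inc_prod s k * dec_prod (fun i => s i - (c i)%:A) m
    = dec_prod (fun i => s i.+1 - (c i)%:A) m * inc_prod s k.
Proof.
move=> sH le_k; elim: m => [|m IH] lt_m /=; first by rewrite mulr1 mul1r.
rewrite mulrA mulrBr (inc_prod_shift sH)// -scalerAr
  mulr1 -[_ *: inc_prod s k]mul1r.
rewrite -scalerAr scalerAl -mulrBl -!mulrA IH// ltnW//.
Qed.

(** Here k = n gives (1 - u) e D V = e (X - u) with X the last Jucys-Murphy
    element, so that e (X - u) is, up to 1 - u, the product of e with
    inverse intertwiners. The induction adds one factor at the middle of
    both palindromes and compares the new terms by [dec_prod_interpolation]. *)
Lemma jm_interpolation n s k (e : A) : hecke_family q n s -> (k <= n)%N ->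
  (forall j, (j < k)%N -> u != x j) ->
  (forall j, (j < k)%N -> e * jm (fun i => s i.+1) j = x j *: e) ->
  (1 - u) *: (e * (inc_prod s k * dec_prod (fun i => s i - (b i)%:A) k))
    = e * (inc_prod s k * dec_prod s k) - u *: e.
Proof.
move=> sH; elim: k => [|k IH] le_k ux ex /=.
  by rewrite !mulr1 scalerBl scale1r.
have {}IH := IH (ltnW le_k) (fun j lt => ux j (ltnW lt)) (fun j lt =>
  ex j (ltnW lt)).
have lt_kn : (k <= n.-1)%N by lia.
have s'H := hecke_family_shift sH.
have eU := right_weight_dec_prod s'H lt_kn (ex k (ltnSn k)).
have I2 := dec_prod_interpolation s'H lt_kn (fun j lt => ux j (ltnW lt))
   (fun j lt => ex j (ltnW lt)).
have sb : inc_prod s k.+1 * dec_prod (fun i => s i - (b i)%:A) k =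
    dec_prod (fun i => s i.+1 - (b i)%:A) k * inc_prod s k.+1.
  exact: inc_dec_prod_shift sH _ _.
have su : inc_prod s k.+1 * dec_prod s k = dec_prod (fun i => s i.+1) k *
  inc_prod s k.+1.
  have := inc_dec_prod_shift (fun=> 0) sH le_k (ltnSn k).
  rewrite (@eq_dec_prod (fun i => s i - 0%:A) s) => [->|i _];
    last by rewrite scale0r subr0.
  by congr (_ * _); apply: eq_dec_prod => i _; rewrite scale0r subr0.
have quad : s k * s k = 1 + h *: s k by case: sH => ->.
have -> : e * (inc_prod s k * s k *
  ((s k - (b k)%:A) * dec_prod (fun i => s i - (b i)%:A) k))
  = e * (inc_prod s k * dec_prod (fun i => s i - (b i)%:A) k)
    + (h - b k) *: (e * (inc_prod s k.+1 * dec_prod (fun i => s i - (b i)%:A)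
      k)).
  rewrite /= -mulrA [s k * (_ * _)]mulrA mulrBr quad -scalerAr mulr1.
  rewrite -addrA -scalerBl mulrDl mul1r -scalerAl mulrDr mulrDr -!scalerAr.
  by rewrite !mulrA.
have -> : e * (inc_prod s k * s k * (s k * dec_prod s k))
   = e * (inc_prod s k * dec_prod s k) + h *:
     (e * (inc_prod s k.+1 * dec_prod s k)).
  rewrite /= -mulrA [s k * (_ * _)]mulrA quad.
  rewrite mulrDl mul1r -scalerAl mulrDr mulrDr -!scalerAr.
  by rewrite !mulrA.
rewrite sb su !(mulrA e _ (inc_prod s k.+1)).
set w := e * dec_prod (fun i => s i.+1 - (b i)%:A) k * inc_prod s k.+1.
set e1 := e * dec_prod (fun i => s i.+1 - h%:A) k * inc_prod s k.+1.
have -> : e * dec_prod (fun i => s i.+1) k * inc_prod s k.+1 = x k *: e1.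
  by rewrite eU -scalerAl.
have {}I2 : (u - 1) *: w = (u - x k) *: e1.
  rewrite scalerAl I2 eU mulrBl -!scalerAl -scalerBl//.
have uk : u - x k != 0 by rewrite subr_eq0 ux.
set m1 := e * (inc_prod s k * dec_prod (fun i => s i - (b i)%:A) k) in IH *.
have -> : (1 - u) *: (m1 + (h - b k) *: w)
    = (1 - u) *: m1 - (h - b k) *: ((u - 1) *: w) by lin_comb K; ring.
rewrite IH I2; set m2 := e * (_ * _).
by rewrite /b; move: (h) => c; lin_comb K; field.
Qed.

Lemma dec_inc_prod_phi n s k : hecke_family q n s -> (k <= n)%N ->
  (forall j, (j < k)%N -> u != x j) ->
  dec_prod (fun i => s i - (b i)%:A) k * inc_prod (fun i => s i + (a i)%:A) k
    = (\prod_(i < k) (1 - a i * b i))%:A.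
Proof.
move=> sH; elim: k => [|k IH] le_k ux /=;
  first by rewrite big_ord0 mulr1 scale1r.
have quad : s k * s k = 1 + h *: s k by case: sH => ->.
have uk : u - x k != 0 by rewrite subr_eq0 ux.
have core (c a' b' : K) : s k * s k = 1 + c *: s k -> c + a' = b' ->
    (s k - b'%:A) * (s k + a'%:A) = (1 - a' * b')%:A.
  move=> sk ab; rewrite !algE sk; lin_comb K; ring: (esym ab).
have {}core : (s k - (b k)%:A) * (s k + (a k)%:A) = (1 - a k * b k)%:A.
  by apply: core quad _; rewrite /a /b; move: (h) => c; field.
rewrite -mulrA [dec_prod _ _ * (_ * _)]mulrA IH; first last.
- by move=> j lt_j; apply: ux; exact: ltnW.
- exact: ltnW.
by rewrite -scalerAl mul1r -scalerAr core scalerA big_ord_recr.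
Qed.

(** Multiplying [jm_interpolation] by the intertwiners of the block leaves a
    scalar, whose factor for the label of weight q ^- 2 * u is zero.
    Reversing the generators turns the last Jucys-Murphy element of t into
    the palindrome of that lemma. *)
Lemma jm_top_weight n t ys (e : A) :
  hecke_family q n t -> size ys = n -> (forall j, ys`_j = x j) ->
  q != 0 -> (forall j, (j < n)%N -> x j != 0) ->
  (forall j, (j < n)%N -> u != x j) ->
  (forall j, (j < n)%N -> e * jm (fun i => t (n - i.+2)%N) j = x j *: e) ->
  (exists2 j, (j < n)%N & u = q ^+ 2 * x j) ->
  GRing.comm e (jm t n) ->
  jm t n * (e * block q t ys u) = u *: (e * block q t ys u).
Proof.
move=> tH sz ysx q0 xN0 ux ex [j0 lt_j0 u_j0] eX.
set s := fun i => t (n - i.+1)%N.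
have sH : hecke_family q n s.
  case: (tH) => quad braid far; rewrite /s;
    split=> [k lt_k|k lt_k|i j lt_ij lt_j].
  - by apply: quad; lia.
  - have -> : (n - k.+1 = (n - k.+2).+1)%N by lia.
    by apply/esym/braid; lia.
  - by apply/esym/far; lia.
have XE : jm t n = inc_prod s n * dec_prod s n by rewrite jmE dec_prod_rev
  (inc_prod_rev t).
have := jm_interpolation sH (leqnn n) ux (e := e) ex.
rewrite -XE => main.
have BE : block q t ys u = inc_prod (fun i => s i + (a i)%:A) n.
  rewrite block_inc_prod sz; apply: eq_inc_prod => i lt_i.
  by rewrite /phi ysx /s /a phi_coef ?subr_eq0 ?ux ?xN0.
have : (1 - u) *: (e * (inc_prod s n * dec_prod (fun i => s i - (b i)%:A) n)) *
  block q t ys u = 0.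
  rewrite -scalerAl -!mulrA BE (dec_inc_prod_phi sH)//.
  rewrite (bigD1 (Ordinal lt_j0))//=.
  have -> : 1 - a j0 * b j0 = 0.
    rewrite /a /b; have := ux _ lt_j0; rewrite u_j0 => ne.
    have xj0 := xN0 _ lt_j0.
    have q21 : q ^+ 2 - 1 != 0.
      apply: contraNneq ne => /subr0_eq ->; exact/eqP/mul1r.
    field; rewrite q0 /=.
    have -> : q ^+ 2 * x j0 - x j0 = (q ^+ 2 - 1) * x j0 by ring.
    by rewrite mulf_neq0.
  by rewrite mul0r scale0r !mulr0 scaler0.
rewrite main mulrBl -scalerAl => /subr0_eq <-.
by rewrite mulrA eX.
Qed.

End Top.
End JM.

(** * The opposite algebra *)

Section Converse.
Variables (K : fieldType) (A : algType K).
HB.instance Definition _ := GRing.Lmodule.copy A^c A.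

Lemma converse_scaleAl (a : K) (x y : A^c) : a *: (x * y : A^c) =
  (a *: x : A^c) * y.
Proof. exact: (@scalerAr K A a y x). Qed.
HB.instance Definition _ := GRing.Lmodule_isLalgebra.Build K A^c
  converse_scaleAl.

Lemma converse_scaleAr (a : K) (x y : A^c) : a *: (x * y : A^c) = x *
  (a *: y : A^c).
Proof. exact: (@scalerAl K A a y x). Qed.
HB.instance Definition _ := GRing.Lalgebra_isAlgebra.Build K A^c
  converse_scaleAr.
End Converse.

Section Mirror.
Variables (K : fieldType) (q : K).

Lemma mulr_converse (A : algType K) (x y : A) : (x : A^c) * (y : A^c) = y * x.
Proof. by []. Qed.

Lemma hecke_family_mirror (A : algType K) n (t : nat -> A) :
  hecke_family q n t -> hecke_family q n (fun k => t (n - k.+1)%N : A^c).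
Proof.
case=> quad braid far; split=> [k lt_k|k lt_k|i j lt_ij lt_j].
- by apply: (quad (n - k.+1)%N); lia.
- have E : (n - k.+1 = (n - k.+2).+1)%N by lia.
  have := braid (n - k.+2)%N; rewrite -E => /(_ ltac:(lia)) br.
  by rewrite !mulr_converse !mulrA br.
- by rewrite !mulr_converse; apply: far; lia.
Qed.

Lemma jm_converse (A : algType K) (t : nat -> A) k :
  @jm K A^c t k = jm t k.
Proof. by elim: k => //= k ->; rewrite !mulr_converse mulrA. Qed.

(** Passing to the opposite algebra reverses the order of the factors;
    numbering the generators backwards restores the indices for the reversed
    list of letters. *)
Lemma block_converse (A : algType K) (t t' : nat -> A) ys u :
  (forall k, (k < size ys)%N -> t' k = t (size ys - k.+1)%N) ->
  @block K q A^c t' ys u = @block K q A t (rev ys) u.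
Proof.
elim: ys t => //= y ys IH t tt'.
rewrite rev_cons -cats1 block_cat /= mulr1 mulr_converse; congr (_ * _).
  by rewrite /phi tt'// subSS subnn.
rewrite (IH (fun k => t (k + 1)%N)) // => k lt_k.
by rewrite tt' ?ltnS 1?ltnW//; congr t; lia.
Qed.

(** The reversed product starts with the block of the last letter, as does
    the right-hand side of [fusion_prod_block]. *)
Lemma fusion_prod_converse (A : algType K) n (t t' : nat -> A) ys :
  hecke_family q n t -> (size ys <= n.+1)%N -> generic ys ->
  (forall k, (k.+1 < size ys)%N -> t' k = t (size ys - k.+2)%N) ->
  @fusion_prod K q A^c t' ys = @fusion_prod K q A t ys.
Proof.
elim/last_ind: ys n t => [|ys u IH] n t tH;
  first by rewrite /fusion_prod !big_ord0.
rewrite size_rcons => lt_n gen tt'; rewrite !fusion_prod_rcons mulr_converse.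
rewrite (block_converse (t := t)); last first.
  by move=> k lt_k; rewrite tt'// subSS.
rewrite (@fusion_prod_block _ _ _ n)//.
rewrite (IH n.-1 (fun k => t k.+1))//.
- exact: hecke_family_shift.
- lia.
- by move: gen; rewrite generic_rcons => /and3P[].
- by move=> k lt_k; rewrite tt' 1?ltnW//; congr t; lia.
Qed.

Hypothesis q0 : q != 0.
Hypothesis q_gen : forall n, (0 < n)%N -> q ^+ n != 1.

(** This is [fusion_prod_mulr_eq0] in the opposite algebra. *)
Lemma fusion_prod_mull_eq0 (A : algType K) n (t : nat -> A) ys i :
  hecke_family q n t -> generic ys -> (size ys <= n.+1)%N ->
    (i.+1 < size ys)%N ->
  ys`_i.+1 = q ^- 2 * ys`_i ->
  (t i + q^-1%:A) * fusion_prod q t ys = 0.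
Proof.
move=> tH gen le_n lt_i yi.
have tH' : hecke_family q (size ys).-1 t by apply: hecke_family_le tH; lia.
have := @fusion_prod_mulr_eq0 K q _ q0 q_gen _ _ _ i (hecke_family_mirror tH')
  gen _ lt_i yi.
rewrite (fusion_prod_converse tH)//; last by move=> k lt_k; congr t; lia.
rewrite mulr_converse => H; have := H _; have -> :
  ((size ys).-1 - (size ys - i.+2).+1 = i)%N by lia.
by apply; lia.
Qed.

End Mirror.

(** * Regular values on a subspace *)

Section RegularValue.
Import mpoly.
Variables (K : fieldType) (l : nat) (Z D : set ('I_l -> K)) (p : 'I_l -> K).
Notation rv f v := (regular_value Z D f p v).

Section Mod.
Variable M : lmodType K.
Implicit Types (f g : ('I_l -> K) -> M) (v w : M).

Lemma regular_value_fin (I : finType) (P Q : I -> mpoly l K) (w : I -> M) f :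
  (forall k, (Q k).@[p] != 0) ->
  (forall z, Z z -> D z -> (forall k, (Q k).@[z] != 0) ->
     f z = \sum_k ((P k).@[z] / (Q k).@[z]) *: w k) ->
  rv f (\sum_k ((P k).@[p] / (Q k).@[p]) *: w k).
Proof.
move=> Qp fE; exists #|I|, (P \o enum_val), (Q \o enum_val), (w \o enum_val).
split=> [k|z Zz Dz Qz|]; first exact: Qp.
  rewrite fE//; first by rewrite (big_enum_val (A := I)).
  by move=> k; rewrite -(enum_rankK k); apply: Qz.
by rewrite (big_enum_val (A := I)).
Qed.

Lemma regular_value_ext f g v :
  (forall z, Z z -> D z -> f z = g z) -> rv g v -> rv f v.
Proof.
move=> fg [n [P [Q [w [Qp gE ->]]]]]; exists n, P, Q, w; split=> // z Zz Dz Qz.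
by rewrite fg// gE.
Qed.

Lemma regular_value_frac (P Q : mpoly l K) (r : ('I_l -> K) -> K) v :
  Q.@[p] != 0 ->
  (forall z, Z z -> D z -> Q.@[z] != 0 -> r z = P.@[z] / Q.@[z]) ->
  rv (fun z => r z *: v) ((P.@[p] / Q.@[p]) *: v).
Proof.
move=> Qp rE; exists 1%N, (fun=> P), (fun=> Q), (fun=> v).
split=> [//|z Zz Dz Qz|]; rewrite big_ord1//.
by rewrite rE//; exact: Qz ord0.
Qed.

Lemma regular_value_cst v : rv (fun=> v) v.
Proof.
exists 1%N, (fun=> 1), (fun=> 1), (fun=> v); split=> [_|z _ _ _|].
- by rewrite meval1 oner_eq0.
- by rewrite big_ord1 meval1 divr1 scale1r.
- by rewrite big_ord1 meval1 divr1 scale1r.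
Qed.

Lemma regular_valueD f g v w : rv f v -> rv g w ->
  rv (fun z => f z + g z) (v + w).
Proof.
case=> [n [P [Q [a [Qp fE ->]]]]] [n' [P' [Q' [a' [Qp' gE ->]]]]].
pose S A (F : 'I_n -> A) (G : 'I_n' -> A) (i : 'I_n + 'I_n') : A :=
  match i with inl i => F i | inr j => G j end.
have := @regular_value_fin ('I_n + 'I_n')%type (S _ P P') (S _ Q Q') (S _ a a')
  (fun z => f z + g z).
rewrite big_sumType /=; apply=> [[]//|z Zz Dz Qz].
rewrite big_sumType /= fE ?gE// => k.
  exact: (Qz (inr k)).
exact: (Qz (inl k)).
Qed.

Lemma regular_valueN f v : rv f v -> rv (fun z => - f z) (- v).
Proof.
case=> [n [P [Q [a [Qp fE ->]]]]]; exists n, P, Q, (fun k => - a k).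
split=> // [z Zz Dz Qz|]; first by rewrite fE// -sumrN; apply: eq_bigr => k _;
  rewrite scalerN.
by rewrite -sumrN; apply: eq_bigr => k _; rewrite scalerN.
Qed.
End Mod.

(** The case of an empty family is separate: the denominators of one factor
    are then not tested by the hypothesis on their products. *)
Lemma regular_valueM (A : algType K) (f g : ('I_l -> K) -> A) (v w : A) :
  rv f v -> rv g w -> rv (fun z => f z * g z) (v * w).
Proof.
case=> [n [P [Q [a [Qp fE ->]]]]] [n' [P' [Q' [a' [Qp' gE ->]]]]].
have := @regular_value_fin A ('I_n * 'I_n')%type (fun k => P k.1 * P' k.2)
  (fun k => Q k.1 * Q' k.2) (fun k => a k.1 * a' k.2) (fun z => f z * g z).
have E z : \sum_(k : 'I_n * 'I_n')
     (((P k.1 * P' k.2).@[z] / (Q k.1 * Q' k.2).@[z]) *: (a k.1 * a' k.2))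
   = (\sum_k ((P k).@[z] / (Q k).@[z]) *: a k)
     * (\sum_k ((P' k).@[z] / (Q' k).@[z]) *: a' k).
  rewrite big_distrlr /= pair_big /=; apply: eq_bigr => -[i j] _ /=.
  by rewrite -scalerAl -scalerAr scalerA !mevalM mulf_div.
rewrite E; apply=> [k|z Zz Dz Qz]; first by rewrite mevalM mulf_neq0.
rewrite E; case: n P Q a Qp fE Qz {E} => [|n] P Q a Qp fE Qz.
  by rewrite fE ?big_ord0 ?mul0r// => -[].
case: n' P' Q' a' Qp' gE Qz => [|n'] P' Q' a' Qp' gE Qz.
  by rewrite gE ?big_ord0 ?mulr0// => -[].
rewrite fE ?gE// => k.
  by have := Qz (ord0, k); rewrite mevalM mulf_eq0 negb_or => /andP[].
by have := Qz (k, ord0); rewrite mevalM mulf_eq0 negb_or => /andP[].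
Qed.

(** On the curve z_i = 1 + t * b_i, which meets the excluded locus in
    finitely many points, the functions become rational in t, and the value
    at t = 0 is determined by the values at other points. *)
Section Unique.
Hypothesis char0 : forall n, (0 < n)%N -> n%:R != 0 :> K.
Variables (b : 'I_l -> K) (B : {poly K}).
Hypothesis B0 : B != 0.
Hypothesis curve : forall t, B.[t] != 0 -> Z (fun i => 1 + t * b i) /\
  D (fun i => 1 + t * b i).
Hypothesis p1 : p = fun=> 1.

Lemma sample_points (C : {poly K}) n : C != 0 ->
  exists2 xs : seq K, uniq xs & size xs = n /\ forall x, x \in xs -> C.[x] != 0.
Proof.
move=> C0; pose s : seq K := [seq i%:R | i <- iota 0 (n + size C)].
have us : uniq s.
  rewrite map_inj_uniq ?iota_uniq// => i j.
  wlog le_ij : i j / (i <= j)%N.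
    by move=> W; case: (leqP i j) => [/W//|/ltnW/W W' /esym/W'].
  move=> /eqP; rewrite -(subnKC le_ij) natrD -subr_eq0 opprD addrA subrr add0r
    oppr_eq0.
  by case: (j - i)%N => [|k]; rewrite ?addn0// => /negPn; rewrite char0.
exists (take n (filter (predC (root C)) s));
  first by rewrite take_uniq// filter_uniq.
split=> [|x /mem_take]; last by rewrite mem_filter => /andP[].
apply: size_takel; rewrite size_filter.
have := count_predC (root C) s.
have -> : size s = (n + size C)%N by rewrite size_map size_iota.
have : (count (root C) s < size C)%N.
  rewrite -size_filter; apply: max_poly_roots;
    rewrite ?filter_all ?filter_uniq//.
move: (count _ s) (count _ s) (size C) => x y m; lia.
Qed.

(** Newton interpolation at 0. The coefficients do not depend on P, so the
    statement also applies to polynomials with values in a vector space. *)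
Lemma extrapolation (xs : seq K) : uniq xs ->
  exists c : K -> K, forall P : {poly K}, (size P <= size xs)%N ->
    P.[0] = \sum_(x <- xs) c x * P.[x].
Proof.
elim: xs => [_|x0 xs IH /= /andP[x0s /IH[c cE]]].
  exists (fun=> 0) => P; rewrite leqn0 size_poly_eq0 => /eqP->.
  by rewrite big_nil horner0.
pose d x := - x0 * c x / (x - x0).
exists (fun x => if x == x0 then 1 - \sum_(y <- xs) d y else d x) => P szP.
have [G PE] : exists G, P - P.[x0]%:P = G * ('X - x0%:P).
  by apply/factor_theorem; rewrite /root hornerD hornerN hornerC subrr.
have Gx x : P.[x] = P.[x0] + G.[x] * (x - x0).
  have /(congr1 (horner^~ x)) := PE; rewrite hornerM hornerXsubC hornerD hornerN
    hornerC.
  by move=> <-; rewrite addrC subrK.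
have szG : (size G <= size xs)%N.
  have [->|G0] := eqVneq G 0; first by rewrite size_poly0.
  have : size (G * ('X - x0%:P)) = (size G).+1.
    by rewrite size_Mmonic ?monicXsubC// size_XsubC addn2.
  rewrite -PE -ltnS => <-; apply: leq_trans (size_polyD _ _) _.
  by rewrite geq_max szP size_polyN (leq_trans (size_polyC_leq1 _)).
rewrite big_cons eqxx Gx cE// sub0r.
under [X in _ = _ + X]eq_big_seq => x xx.
  rewrite ifN; last by apply: contraNneq x0s => <-.
  rewrite Gx mulrDr /d [X in _ + X](_ : _ = c x * G.[x] * - x0); last first.
    have : x - x0 != 0 by rewrite subr_eq0; apply: contraNneq x0s => <-.
    by move=> ?; field.
  over.
rewrite big_split /= -!mulr_suml -/d; ring.
Qed.

Lemma meval_curve (P : mpoly l K) :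
  exists P' : {poly K}, forall t, P'.[t] = P.@[fun i => 1 + t * b i].
Proof.
exists (\sum_(m <- msupp P) P@_m *: \prod_i (1 + b i *: 'X) ^+ m i) => t.
rewrite mevalE horner_sum; apply: eq_bigr => m _; rewrite hornerZ horner_prod.
congr (_ * _); apply: eq_bigr => i _.
by rewrite horner_exp hornerD hornerZ hornerX hornerC mulrC.
Qed.

Lemma regular_value_eq0 (M : lmodType K) (v : M) : rv (fun=> 0) v -> v = 0.
Proof.
case=> [n [P [Q [w [Qp fE ->]]]]].
pose P' k := projT1 (cid (meval_curve (P k))).
pose Q' k := projT1 (cid (meval_curve (Q k))).
have P'E k t : (P' k).[t] = (P k).@[fun i => 1 + t * b i].
  by rewrite /P'; case: cid.
have Q'E k t : (Q' k).[t] = (Q k).@[fun i => 1 + t * b i].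
  by rewrite /Q'; case: cid.
have pE : (fun i => 1 + 0 * b i) = p by rewrite p1; apply/funext => i;
  rewrite mul0r addr0.
have Q'0 k : (Q' k).[0] != 0 by rewrite Q'E pE.
pose C := B * \prod_k Q' k.
have C0 : C != 0.
  rewrite mulf_neq0//; apply/prodf_neq0 => k _.
  by apply: contraNneq (Q'0 k) => ->; rewrite horner0.
pose R k := P' k * \prod_(j | j != k) Q' j.
have [xs uxs [sz Cx]] := sample_points (\max_k size (R k)) C0.
have [c cE] := extrapolation uxs.
have RE k t : (\prod_j Q' j).[t] != 0 ->
    (R k).[t] = (\prod_j Q' j).[t] * ((P' k).[t] / (Q' k).[t]).
  rewrite (bigD1 k)//= /R !hornerM mulf_eq0 negb_or => /andP[Qk0 _].
  by field.
have R0 : \sum_k (R k).[0] *: w k = 0.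
  under eq_bigr => k _ do rewrite cE ?sz ?(leq_bigmax k)// scaler_suml.
  rewrite exchange_big big_seq big1// => x /Cx /=.
  rewrite /C hornerM mulf_eq0 negb_or => /andP[Bx Qx].
  under eq_bigr => k _ do rewrite -scalerA RE// -scalerA P'E Q'E.
  rewrite -!scaler_sumr -fE ?scaler0//; [by case: (curve Bx)..|].
  move=> k; rewrite -Q'E; apply: contraNneq Qx => Qk.
  by rewrite (bigD1 k)//= hornerM Qk mul0r.
have Q00 : (\prod_j Q' j).[0] != 0 by rewrite horner_prod; apply/prodf_neq0.
apply/eqP; rewrite -(inj_eq (scalerI Q00)) scaler0 scaler_sumr; apply/eqP.
rewrite -[RHS]R0; apply: eq_bigr => k _.
by rewrite RE// scalerA P'E Q'E pE.
Qed.

Lemma regular_value_uniq (M : lmodType K) (f : ('I_l -> K) -> M) v w :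
  rv f v -> rv f w -> v = w.
Proof.
move=> fv fw; apply/subr0_eq/regular_value_eq0.
apply: regular_value_ext (regular_valueD fv (regular_valueN fw)) => z _ _.
by rewrite subrr.
Qed.
End Unique.
End RegularValue.

(** * Regularity and weights of the fusion product *)

Section JMcomm.
Variables (K : fieldType) (q : K) (A : algType K) (n : nat) (t : nat -> A).
Hypothesis tH : hecke_family q n t.

(** For k = i.+2 this is the braid relation, used twice around the
    palindrome; larger k follow since t i commutes with the new generator. *)
Lemma jm_comm i k : (i.+1 < k)%N -> (k <= n)%N -> GRing.comm (t i) (jm t k).
Proof.
elim: k i => // k IH i; rewrite ltnS leq_eqVlt => /predU1P[<-|lt_i] le_k.
  have [quad braid far] := tH; have br := braid i le_k.
  rewrite /GRing.comm /=.
  have ti : GRing.comm (t i.+1) (jm t i).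
    by apply: comm_jm => j lt_j; apply/commr_sym/far; lia.
  (* jm t i.+2 = t i.+1 * t i * jm t i * t i * t i.+1, where jm t i commutes
     with t i.+1: the braid relation is used on the left, then on the right. *)
  transitivity (t i * t i.+1 * t i * jm t i * t i * t i.+1);
    first by rewrite !mulrA.
  rewrite br -(mulrA _ _ (jm t i)) ti.
  transitivity (t i.+1 * t i * jm t i * (t i.+1 * t i * t i.+1));
    first by rewrite !mulrA.
  by rewrite -br !mulrA.
have tk : GRing.comm (t i) (t k) by apply: (hecke_far tH); lia.
by apply/commrM => //; apply/commrM => //; apply: IH => //; exact: ltnW.
Qed.
End JMcomm.

Section Merge.
Variables (K : fieldType) (q : K) (A : algType K) (t : nat -> A) (k : nat).
Notation h := (q - q^-1).
Hypothesis q0 : q != 0.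

(** The only term with the denominator y - x is E * (t k + q^-1%:A) up to a
    regular one: replacing E * t k by - q^-1 *: E leaves the coefficient a *
    (b - q^-1), whose numerator cancels this denominator. *)
Lemma merge_factors (E : A) x y w : E * (t k + q^-1%:A) = 0 ->
  w = q ^- 2 * x -> x != 0 -> w != 0 -> y - x != 0 -> y - w != 0 ->
  E * (phi q t k.+1 x y * phi q t k w y)
    = E * (t k.+1 * t k + (h * w / (y - w)) *: t k.+1 +
      ((- h * q * w) / (y - w))%:A).
Proof.
move=> E0 wE x0 w0 yx yw; rewrite /phi !phi_coef//.
have Et : E * t k = - q^-1 *: E.
  by apply/eqP; rewrite -subr_eq0 scaleNr opprK -[_ *: E]mulr1 -scalerAl
    scalerAr -mulrDr E0.
set a := h * x / _; set b := h * w / _; set d := (- h * q * w) / _.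
have abd : a * (b - q^-1) = d.
  have q20 : q ^+ 2 != 0 by rewrite expf_neq0.
  have xE : x = q ^+ 2 * w by rewrite wE mulrA divff ?mul1r.
  move: yx yw; rewrite /a /b /d xE => yx yw.
  by field; rewrite q0 yx yw.
rewrite -abd; clearbody a b; rewrite !algE Et; lin_comb K; ring.
Qed.
End Merge.

(** The label i + 1 has content c i and lies in the column col i. *)
Section Regularity.
Import mpoly.
Variables (K : fieldType) (q : K) (l : nat) (c : nat -> int) (col : nat -> nat).
Notation h := (q - q^-1).
Hypothesis q0 : q != 0.
Hypothesis q_gen : forall n, (0 < n)%N -> q ^+ n != 1.

Definition arg (z : 'I_l -> K) (i : 'I_l) : K := q ^ (2 * c i) * z i.
Definition col_space : set ('I_l -> K) :=
  [set z | forall i j : 'I_l, col i = col j -> z i = z j]%classic.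
Definition arg_dom : set ('I_l -> K) :=
  [set z | (forall i, z i != 0) /\
     forall i j : 'I_l, (i < j)%N -> arg z i != arg z j]%classic.
Notation rv f v := (regular_value col_space arg_dom f (fun=> 1) v).

Lemma q_int_neq1 (n : int) : n != 0 -> q ^ n != 1.
Proof.
case: n => [[|n]|n] //= _; first exact: q_gen.
by rewrite (_ : q ^ Negz n = (q ^+ n.+1)^-1)// invr_eq1; exact: q_gen.
Qed.

Lemma q_inj a b : q ^ (2 * a) = q ^ (2 * b) -> a = b.
Proof.
move=> ab; apply/eqP; rewrite -subr_eq0; apply: contraTT isT => ab0.
have /negP[] : q ^ (2 * (a - b)) != 1 by apply: q_int_neq1; rewrite mulf_neq0.
by rewrite mulrBr expfzDr// -invr_expz ab divff// expfz_neq0.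
Qed.

Definition args z : seq K := [seq arg z i | i <- enum 'I_l].

Lemma size_args z : size (args z) = l.
Proof. by rewrite size_map size_enum_ord. Qed.

Lemma nth_args z (i : 'I_l) : (args z)`_i = arg z i.
Proof. by rewrite (nth_map i) ?size_enum_ord// nth_ord_enum. Qed.

Lemma generic_args m z : arg_dom z -> generic (take m (args z)).
Proof.
move=> [z0 zne]; apply/andP; split.
  apply/take_uniq; rewrite map_inj_in_uniq ?enum_uniq// => i j _ _ ij.
  by apply/val_inj; case: (ltngtP i j) => // lt; have := zne _ _ lt;
    rewrite ij eqxx.
apply/negP => /mem_take/mapP[i _ /esym/eqP];
  rewrite /arg mulf_eq0 (negPf (z0 i)) orbF.
by rewrite expfz_eq0 (negPf q0) andbF.
Qed.

Lemma col_value_frac (M : lmodType K) (al be ga : K) (i j : 'I_l) (v : M) :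
  be != ga ->
  rv (fun z => (al * z i / (be * z j - ga * z i)) *: v) ((al / (be - ga)) *: v).
Proof.
move=> bega.
have := @regular_value_frac K l col_space arg_dom (fun=> 1) M (al *: 'X_i)
  (be *: 'X_j - ga *: 'X_i)
  (fun z => al * z i / (be * z j - ga * z i)) v.
have E z : (be *: 'X_j - ga *: 'X_i).@[z] = be * z j - ga * z i.
  by rewrite mevalB !mevalZ !mevalXU.
rewrite !E mevalZ mevalXU !mulr1; apply; rewrite ?subr_eq0// => z _ _ _.
by rewrite E mevalZ mevalXU.
Qed.

Hypothesis c_rep : forall i j, (i < j < l)%N -> c i = c j ->
  [/\ (i.+1 < j)%N, col i.+1 = col i & c i.+1 = c i - 1].

Section Step.
Variables (A : algType K) (t : nat -> A) (m : nat).
Hypothesis tH : hecke_family q m t.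
Hypothesis lt_m : (m < l)%N.
Notation ys z := (take m (args z)).
Notation u z := (args z)`_m.

Lemma col_value_phi k i : (i < m)%N -> c i <> c m ->
  rv (fun z => phi q t k (args z)`_i (u z))
    (phi q t k (args (fun=> 1))`_i (u (fun=> 1))).
Proof.
move=> lt_im ne; have lt_i : (i < l)%N by apply: ltn_trans lt_m.
pose i' := Ordinal lt_i; pose m' := Ordinal lt_m.
have nx z : (args z)`_i = arg z i' by rewrite -nth_args.
have nu z : (args z)`_m = arg z m' by rewrite -nth_args.
have qne : q ^ (2 * c m) != q ^ (2 * c i) by apply/eqP => /q_inj E; case: ne.
rewrite /phi nx nu [in X in regular_value _ _ _ _ X]phi_coef; last 2 first.
- by rewrite /arg mulr1 expfz_neq0.
- by rewrite /arg !mulr1 subr_eq0.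
apply: regular_valueD; first exact: regular_value_cst.
rewrite [arg (fun=> 1) i']mulr1 [arg (fun=> 1) m']mulr1.
apply: regular_value_ext (col_value_frac (h * q ^ (2 * c i)) i' m' (1 : A)
  qne) => z Zz [z0 zne].
rewrite phi_coef; first by rewrite nx nu mulrA.
  by rewrite nx mulf_neq0 ?expfz_neq0.
by rewrite nx nu subr_eq0 eq_sym zne.
Qed.

Lemma col_value_inc_prod (F : ('I_l -> K) -> nat -> A) f k :
  (forall i, (i < k)%N -> rv (fun z => F z i) (f i)) ->
  rv (fun z => inc_prod (F z) k) (inc_prod f k).
Proof.
elim: k => [_|k IH rvF] /=; first exact: regular_value_cst.
by apply: regular_valueM; [apply: IH => i ?; apply: rvF;
  apply: ltnW|apply: rvF].
Qed.

Lemma size_ys z : size (ys z) = m.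
Proof. by rewrite size_takel// size_args ltnW. Qed.

Lemma block_ys z :
  block q t (ys z) (u z) = inc_prod (fun i => phi q t (m - i.+1)%N (args z)`_i
    (u z)) m.
Proof.
by rewrite block_inc_prod size_ys; apply: eq_inc_prod => i lt_i;
  rewrite nth_take.
Qed.

(** Unless two of its labels lie on the same diagonal, no factor has a pole. *)
Lemma col_value_block : (forall i, (i < m)%N -> c i <> c m) ->
  rv (fun z => block q t (ys z) (u z)) (block q t (ys (fun=> 1)) (u (fun=> 1))).
Proof.
move=> ne; rewrite block_ys.
pose F z i := phi q t (m - i.+1)%N (args z)`_i (u z).
apply: (regular_value_ext (g := fun z => inc_prod (F z) m)) => [z _ _|];
  first exact: block_ys.
by apply: col_value_inc_prod => i lt_i; apply: col_value_phi (ne _ lt_i).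
Qed.

Lemma nth_ys z i : (i < m)%N -> (ys z)`_i = (args z)`_i.
Proof. by move=> lt_i; rewrite nth_take. Qed.

Lemma arg_neq0 z i : arg_dom z -> (i < l)%N -> (args z)`_i != 0.
Proof.
move=> [z0 _] lt_i; rewrite (nth_args z (Ordinal lt_i)) mulf_neq0//.
by rewrite expfz_neq0.
Qed.

Lemma arg_sub_neq0 z i j : arg_dom z -> (i < j < l)%N ->
  (args z)`_j - (args z)`_i != 0.
Proof.
move=> [_ zne] /andP[lt_ij lt_j]; have lt_i := ltn_trans lt_ij lt_j.
rewrite (nth_args z (Ordinal lt_i)) (nth_args z (Ordinal lt_j)) subr_eq0 eq_sym.
exact: zne.
Qed.

Lemma col_step z i : col_space z -> (i.+1 < l)%N -> col i.+1 = col i ->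
  c i.+1 = c i - 1 -> (args z)`_i.+1 = q ^- 2 * (args z)`_i.
Proof.
move=> Zz lt_i coli ci; have lt_i' := ltnW lt_i.
rewrite (nth_args z (Ordinal lt_i)) (nth_args z (Ordinal lt_i')) /arg /= ci.
rewrite (Zz (Ordinal lt_i) (Ordinal lt_i') coli) mulrA; congr (_ * _).
by rewrite mulrBr expfzDr// mulrC.
Qed.

(** The factors are treated from left to right. When the label i lies on the
    diagonal of the last letter, the factors i and i + 1 are merged, so that
    a prefix ending between them is skipped; the merged prefix involves
    generators of high index only, hence commutes with the one that
    annihilates the product of the earlier blocks. *)
Lemma block_regular : exists (G : ('I_l -> K) -> A) g, rv G g /\
  forall z, col_space z -> arg_dom z ->
    fusion_prod q t (ys z) * block q t (ys z) (u z) = fusion_prod q t (ys z) *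
      G z.
Proof.
pose F z i := phi q t (m - i.+1)%N (args z)`_i (u z).
pose good i := exists (G : ('I_l -> K) -> A) g, [/\ rv G g,
  forall z, col_space z -> arg_dom z ->
    fusion_prod q t (ys z) * inc_prod (F z) i = fusion_prod q t (ys z) * G z &
  forall z k, (k + i.+1 < m)%N -> GRing.comm (t k) (G z)].
have step i : (i <= m)%N -> good i \/ [/\ (0 < i)%N, good i.-1 & c i.-1 = c m].
  elim: i => [|i IH] lt_i.
    left; exists (fun=> 1), 1; split=> [|z _ _|z k _];
      first exact: regular_value_cst.
      by [].
    exact: commr1.
  have [|[i_gt0]] := IH (ltnW lt_i) => [gi|].
    have [ci|/eqP ci] := eqVneq (c i) (c m); first by right.
    have [G [g [rvG GE Gt]]] := gi; left.
    exists (fun z => G z * F z i), (g * F (fun=> 1) i); split.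
    - by apply: regular_valueM rvG _; apply: col_value_phi.
    - by move=> z Zz Dz; rewrite /= mulrA GE// mulrA.
    - move=> z k lt_k; apply: commrM; first by apply: Gt; lia.
      by apply: comm_phi; apply: (hecke_far tH); lia.
  case: i i_gt0 lt_i {IH} => // i _ lt_i /= [G [g [rvG GE Gt]]] ci; left.
  have [_ coli ci1] := c_rep (j := m) (i := i) ltac:(lia) ci.
  pose k := (m - i.+2)%N.
  have kE : (m - i.+1 = k.+1)%N by rewrite /k; lia.
  pose i1 : 'I_l := Ordinal (ltn_trans lt_i lt_m); pose m' := Ordinal lt_m.
  have qne : q ^ (2 * c m) != q ^ (2 * c i.+1).
    by apply/eqP => /q_inj; rewrite ci1 ci; lia.
  pose w z := (args z)`_i.+1.
  pose H z := t k.+1 * t k + (h * w z / (u z - w z)) *: t k.+1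
     + ((- h * q * w z) / (u z - w z))%:A.
  exists (fun z => G z * H z), (g * H (fun=> 1)); split.
  - apply: regular_valueM rvG _; rewrite /H.
    have wE z : w z = q ^ (2 * c i.+1) * z i1 by rewrite /w (nth_args z i1).
    have uE z : u z = q ^ (2 * c m) * z m' by rewrite (nth_args z m').
    apply: regular_valueD; first apply: regular_valueD;
      first exact: regular_value_cst.
      rewrite !wE !uE !mulr1.
      apply: regular_value_ext (col_value_frac (h * q ^ (2 * c i.+1)) i1 m'
        (t k.+1) qne).
      by move=> z _ _; rewrite wE uE mulrA.
    rewrite !wE !uE !mulr1.
    apply: regular_value_ext (col_value_frac (- h * q * q ^ (2 * c i.+1)) i1 m'
      1 qne).
    by move=> z _ _; rewrite wE uE !mulrA.
  - move=> z Zz Dz; rewrite /= -mulrA [LHS]mulrA GE// !mulrA -mulrA /F kE.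
    rewrite -/k; apply: merge_factors => //.
    + have Et : fusion_prod q t (ys z) * (t k + q^-1%:A) = 0.
        have := @fusion_prod_mulr_eq0 K q A q0 q_gen m t (ys z) i tH
          (generic_args m Dz).
        rewrite size_ys; apply=> //.
        by rewrite !nth_ys//; [apply: col_step => //; lia|lia].
      have tG : GRing.comm (t k) (G z) by apply: Gt; rewrite /k; lia.
      rewrite -mulrA mulrDr -tG -scalerAr mulr1 -[_ *: G z]mul1r -scalerAr
        scalerAl.
      by rewrite -mulrDl mulrA Et mul0r.
    + by apply: col_step => //; lia.
    + by apply: arg_neq0 => //; lia.
    + by apply: arg_neq0 => //; lia.
    + by apply: arg_sub_neq0 => //; lia.
    + by apply: arg_sub_neq0 => //; lia.
  - move=> z j lt_j; apply: commrM; first by apply: Gt; lia.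
    have tk1 : GRing.comm (t j) (t k.+1) by apply: (hecke_far tH); lia.
    have tk : GRing.comm (t j) (t k) by apply: (hecke_far tH); lia.
    apply: commrD; last by rewrite /GRing.comm -scalerAr mulr1 -scalerAl mul1r.
    apply: commrD; first exact: commrM.
    by rewrite /GRing.comm -scalerAr -scalerAl tk1.
have [[G [g [rvG GE _]]]|[m_gt0 _ cm]] := step m (leqnn m).
  exists G, g; split=> // z Zz Dz; rewrite -GE//; congr (_ * _).
  exact: block_ys.
have [] := c_rep (i := m.-1) (j := m) _ cm; first by lia.
by rewrite prednK// ltnn.
Qed.
End Step.

Lemma fusion_prod_take (A : algType K) (t : nat -> A) m z : (m < l)%N ->
  fusion_prod q t (take m.+1 (args z))
    = fusion_prod q t (take m (args z)) * block q t (take m (args z))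
      (args z)`_m.
Proof. by move=> lt_m; rewrite (take_nth 0) ?size_args// fusion_prod_rcons. Qed.

Lemma fusion_prod_regular (A : algType K) (t : nat -> A) m :
  hecke_family q m.-1 t -> (m <= l)%N ->
  exists v, rv (fun z => fusion_prod q t (take m (args z))) v.
Proof.
elim: m => [|m IH] tH lt_m.
  exists 1; apply: regular_value_ext (regular_value_cst _ _ _ _) => z _ _.
  by rewrite take0 /fusion_prod big_ord0.
have [e eE] : exists v, rv (fun z => fusion_prod q t (take m (args z))) v.
  by apply: IH; [exact: hecke_family_le (leq_pred _) tH|exact: ltnW].
have [G [g [rvG GE]]] := block_regular tH lt_m.
exists (e * g); apply: regular_value_ext (regular_valueM eE rvG) => z Zz Dz.
by rewrite fusion_prod_take// GE.
Qed.

Hypothesis char0 : forall n, (0 < n)%N -> n%:R != 0 :> K.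
Hypothesis c_col : forall i j, (i < j < l)%N -> col i = col j -> c i <> c j.

(** The curve has b_i = col i. Two arguments with equal contents belong to
    different columns, hence have different slopes, and the other ones are
    already distinct at t = 0. *)
Lemma col_value_uniq (M : lmodType K) (f : ('I_l -> K) -> M) v w : rv f v ->
  rv f w -> v = w.
Proof.
have nat_inj i j : i%:R = j%:R :> K -> i = j.
  wlog le_ij : i j / (i <= j)%N.
    by move=> W; case: (leqP i j) => [/W//|/ltnW/W W' /esym/W'].
  move=> /eqP; rewrite -(subnKC le_ij) natrD -subr_eq0 opprD addrA subrr add0r
    oppr_eq0.
  by case: (j - i)%N => [|k]; rewrite ?addn0// => /negPn; rewrite char0.
pose a (i : 'I_l) : K := q ^ (2 * c i).
pose b (i : 'I_l) : K := (col i)%:R.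
pose N i : {poly K} := 1 + b i *: 'X.
have NE i t : (N i).[t] = 1 + t * b i.
  by rewrite hornerD hornerC hornerZ hornerX mulrC.
pose B := (\prod_(i < l) N i) * \prod_(i < l) \prod_(j < l | (i < j)%N)
  (a i *: N i - a j *: N j).
apply: (@regular_value_uniq _ _ _ _ _ char0 b B) => //.
  rewrite mulf_neq0//; apply/prodf_neq0 => i _.
    apply/eqP => /(congr1 (horner^~ 0)); rewrite NE horner0 mul0r addr0.
    by apply/eqP/oner_neq0.
  apply/prodf_neq0 => j lt_ij; apply/eqP => /polyP E.
  have := E 0%N; have := E 1%N.
  rewrite !coefD !coefN !coefZ !coefD !coefZ !coefX !coef1 /= !coef0 !mulr0
    !add0r !addr0 !mulr1.
  move=> Eb /subr0_eq/q_inj Ea; have := c_col _ _ Ea; apply; last first.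
    apply: nat_inj; move: Eb; rewrite /a Ea -mulrBr => /eqP.
    by rewrite mulf_eq0 expfz_eq0 (negPf q0) andbF => /eqP/subr0_eq.
  by rewrite lt_ij ltn_ord.
move=> t; rewrite hornerM !horner_prod mulf_eq0 negb_or =>
  /andP[/prodf_neq0 Nt].
move=> /prodf_neq0 Bt; split.
  by move=> i j ij; rewrite /b ij.
split=> [i|i j lt_ij]; first by rewrite -NE; exact: Nt.
have := Bt i isT; rewrite horner_prod => /prodf_neq0/(_ j lt_ij).
by rewrite hornerD hornerN !hornerZ !NE subr_eq0.
Qed.

Hypothesis c0 : c 0%N = 0.
Hypothesis c_next : forall m, (0 < m < l)%N ->
  (col m = col m.-1 /\ c m = c m.-1 - 1) \/
  ((forall i, (i < m)%N -> c i <> c m) /\ exists2 i, (i < m)%N & c m = c i + 1).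

(** The algebra and the generators are universally quantified because the
    induction also uses the opposite algebra, which provides the weights
    from the right. *)
Lemma left_weights m (A : algType K) (t : nat -> A) v :
  hecke_family q m.-1 t -> (m <= l)%N ->
  rv (fun z => fusion_prod q t (take m (args z))) v ->
  forall k, (k < m)%N -> jm t k * v = q ^ (2 * c k) *: v.
Proof.
elim: m A t v => // m IH A t v /= tH lt_m vE.
have tH' : hecke_family q m.-1 t by exact: hecke_family_le (leq_pred _) tH.
have [e eE] := fusion_prod_regular tH' (ltnW lt_m).
have [G [g [rvG GE]]] := block_regular tH lt_m.
have vG : v = e * g.
  apply: col_value_uniq vE _; apply: regular_value_ext
    (regular_valueM eE rvG) => z Zz Dz.
  by rewrite fusion_prod_take// GE.
have size_ys z : size (take m (args z)) = m by rewrite size_takel// size_args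
  ltnW.
have left_e k : (k < m)%N -> jm t k * e = q ^ (2 * c k) *: e.
  exact: IH tH' (ltnW lt_m) eE k.
have right_e k : (k < m)%N -> e * jm (fun i => t (m - i.+2)%N) k =
  q ^ (2 * c k) *: e.
  move=> lt_k; rewrite -(jm_converse (fun i => t (m - i.+2)%N)).
  apply: (IH A^c (fun i => t (m - i.+2)%N) e) lt_k; last 1 first.
  - apply: regular_value_ext eE => z Zz Dz.
    apply: (fusion_prod_converse tH'); rewrite ?size_ys//; first by lia.
    exact: generic_args.
  - have -> : (fun i => t (m - i.+2)%N) = (fun i => t (m.-1 - i.+1)%N).
      by apply/funext => i; congr t; lia.
    exact: hecke_family_mirror.
  - exact: ltnW.
move=> k; rewrite ltnS leq_eqVlt => /predU1P[->{k}|lt_k]; last first.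
  by rewrite vG mulrA left_e// scalerAl.
case: m => [|m] in IH tH lt_m vE tH' e eE rvG GE vG size_ys left_e right_e *.
  by rewrite /= c0 mulr0 expr0z scale1r mul1r.
have [[colm cm]|[cne [i lt_i ci]]] := @c_next m.+1 lt_m.
  have tv : t m * v = - q^-1 *: v.
    have : (t m + q^-1%:A) * v = 0.
      apply: (col_value_uniq (f := fun=> 0)); last exact: regular_value_cst.
      apply: regular_value_ext (regular_valueM (regular_value_cst _ _ _ _)
        vE) => z Zz Dz.
      have sz : size (take m.+2 (args z)) = m.+2 by rewrite size_takel//
        size_args.
      rewrite (@fusion_prod_mull_eq0 _ _ q0 q_gen _ m.+1)// ?sz//;
        first exact: generic_args.
      by rewrite !nth_take//; apply: col_step.
    by move/eqP; rewrite mulrDl -scalerAl mul1r addr_eq0 scaleNr => /eqP.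
  have jv : jm t m * v = q ^ (2 * c m) *: v by rewrite vG mulrA left_e//
    scalerAl.
  rewrite /= -mulrA tv -scalerAr -mulrA jv.
  rewrite -scalerAr tv !scalerA cm /= mulrBr expfzDr//; congr (_ *: _).
  rewrite mulrAC mulrNN -invfM mulrC -expr2; congr (_ * _).
have {G g rvG GE}vG : v = e * block q t (take m.+1 (args (fun=> 1)))
  (args (fun=> 1))`_m.+1.
  apply: col_value_uniq vE _.
  apply: regular_value_ext (regular_valueM eE (col_value_block t lt_m cne)) =>
    z Zz Dz.
  by rewrite fusion_prod_take.
have xs1 j : (j < l)%N -> (args (fun=> 1))`_j = q ^ (2 * c j).
  by move=> lt_j; rewrite (nth_args _ (Ordinal lt_j)) /arg mulr1.
have xs1' j : (j < m.+1)%N -> (take m.+1 (args (fun=> 1)))`_j = q ^ (2 * c j).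
  by move=> lt_j; rewrite nth_take// xs1//; exact: ltn_trans lt_m.
rewrite vG -[in X in _ = X *: _](xs1 m.+1)//.
have := @jm_top_weight K q A (fun j => (take m.+1 (args (fun=> 1)))`_j).
apply=> //.
- by move=> j lt_j; rewrite xs1'// expfz_neq0.
- by move=> j lt_j; rewrite xs1// xs1'//; apply/eqP => /q_inj E; case: (cne j).
- by move=> j lt_j; rewrite xs1'// right_e.
- exists i => //; rewrite xs1// xs1'// ci mulrDr expfzDr// mulrC; congr (_ * _).
apply: (col_value_uniq (f := fun z => fusion_prod q t (take m.+1 (args z)) *
  jm t m.+1)).
  exact: regular_valueM eE (regular_value_cst _ _ _ _).
apply: regular_value_ext (regular_valueM (regular_value_cst _ _ _ _) eE) =>
  z _ _.
apply/commr_sym/comm_fusion_prod => j; rewrite size_ys => lt_j.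
by apply/commr_sym/(jm_comm tH).
Qed.

End Regularity.

(** * Arrangements of labels and the diamond lemma *)

Ltac case_ifs := repeat match goal with
  | |- context [if ?a == ?b then _ else _] =>
    lazymatch a with context [if _ then _ else _] => fail | _ => idtac end;
    case: (eqVneq a b) => ?
  end.

(** An element w of 'S_n.+1 is read as the arrangement with the label w i at
    the place i. Places are natural numbers, so that i.+1 can be written. *)
Section Arrangements.
Local Open Scope nat_scope.
Variable n : nat.
Implicit Types (w : 'S_n.+1) (i j k : nat).

Definition label w i : nat := w (inord i).
Definition swap_pos i j : nat := if j == i then i.+1 else if j == i.+1 then i
  else j.
Definition swap i w : 'S_n.+1 := (tperm (inord i) (inord i.+1) * w)%g.
Definition descent w i : bool := label w i.+1 < label w i.

Lemma label_swap i w j : i < n -> j <= n -> label (swap i w) j =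
  label w (swap_pos i j).
Proof.
move=> lt_i le_j; rewrite /label /swap permM /swap_pos.
case: tpermP => [/(congr1 val)|/(congr1 val)|ni ni1].
- by rewrite /= !inordK ?ltnS// 1?ltnW// => ->; rewrite eqxx.
- by rewrite /= !inordK ?ltnS// => ->; rewrite eqxx gtn_eqF.
- case: eqP => [ji|_]; first by case: ni; rewrite ji.
  by case: eqP => [ji|//]; case: ni1; rewrite ji.
Qed.

Lemma label_inj w i j : i <= n -> j <= n -> label w i = label w j -> i = j.
Proof.
move=> le_i le_j /val_inj/perm_inj/(congr1 val).
by rewrite /= !inordK.
Qed.

Lemma label_ext w w' : (forall i, i <= n -> label w i = label w' i) -> w = w'.
Proof.
move=> E; apply/permP => i; apply/val_inj.
by have := E i; rewrite /label inord_val; apply; rewrite -ltnS.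
Qed.

Lemma label_le w i : label w i <= n. Proof. by rewrite -ltnS /label. Qed.

Lemma label_surj w a : a <= n -> exists2 i, i <= n & label w i = a.
Proof.
move=> le_a; exists ((w^-1)%g (inord a) : 'I_n.+1); first by rewrite -ltnS.
by rewrite /label inord_val permKV inordK.
Qed.

Lemma label_1 i : i <= n -> label 1%g i = i.
Proof. by move=> le_i; rewrite /label perm1 inordK. Qed.

Lemma swapK i w : swap i (swap i w) = w.
Proof. by rewrite /swap mulgA tperm2 mul1g. Qed.

Lemma swap_pos_le i j : i < n -> j <= n -> swap_pos i j <= n.
Proof. by rewrite /swap_pos; case_ifs; lia. Qed.

Lemma swap_far i j w : i.+1 < j < n -> swap i (swap j w) = swap j (swap i w).
Proof.
move=> lt; apply: label_ext => k le_k.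
rewrite !label_swap ?swap_pos_le//; try lia; congr (label w).
by rewrite /swap_pos; case_ifs; lia.
Qed.

Lemma swap_braid i w : i.+1 < n ->
  swap i (swap i.+1 (swap i w)) = swap i.+1 (swap i (swap i.+1 w)).
Proof.
move=> lt; apply: label_ext => k le_k.
rewrite !label_swap ?swap_pos_le//; try lia; congr (label w).
by rewrite /swap_pos; case_ifs; lia.
Qed.

Lemma label_swapl i w : i < n -> label (swap i w) i = label w i.+1.
Proof. by move=> lt_i; rewrite (label_swap w lt_i (ltnW lt_i)) /swap_pos eqxx.
  Qed.

Lemma label_swapr i w : i < n -> label (swap i w) i.+1 = label w i.
Proof. by move=> lt_i; rewrite label_swap//; congr (label w); rewrite /swap_pos;
  case_ifs; lia. Qed.

Lemma label_swapn i w j : i < n -> j <= n -> j != i -> j != i.+1 ->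
  label (swap i w) j = label w j.
Proof. by move=> lt_i le_j ji ji1; rewrite label_swap// /swap_pos (negPf ji)
  (negPf ji1). Qed.

Lemma descent_swap k w : k < n -> descent (swap k w) k = ~~ descent w k.
Proof.
move=> lt_k; rewrite /descent label_swapl// label_swapr//.
have : label w k != label w k.+1 by apply/eqP => /(label_inj (ltnW lt_k) lt_k);
  lia.
by case: ltngtP.
Qed.

(** Strictly decreases when two neighbouring labels in the wrong order are
    swapped: the larger label moves to the place with the smaller
    coefficient. *)
Definition disorder w : nat := \sum_(p < n.+1) (n - p) * label w p.

Lemma disorder_swap i w : i < n -> descent w i ->
  disorder (swap i w) < disorder w.
Proof.
move=> lt_i; rewrite /descent => des.
have lt_i' : i < n.+1 by exact: ltnW.
have lt_i1 : i.+1 < n.+1 by [].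
pose o := Ordinal lt_i'; pose o1 := Ordinal lt_i1.
have oo : o1 != o by apply/eqP => /(congr1 val) /=; lia.
have muE u : disorder u = (n - i) * label u i + ((n - i.+1) * label u i.+1
    + \sum_(p < n.+1 | (p != o) && (p != o1)) (n - p) * label u p).
  by rewrite /disorder (bigD1 o)//= (bigD1 o1).
rewrite !muE label_swapl// label_swapr//.
have -> : \sum_(p < n.+1 | (p != o) && (p != o1)) (n - p) * label (swap i w) p
    = \sum_(p < n.+1 | (p != o) && (p != o1)) (n - p) * label w p.
  apply: eq_bigr => p /andP[po po1]; rewrite label_swapn//; rewrite -ltnS;
    exact: ltn_ord.
have -> : n - i = (n - i.+1).+1 by lia.
by rewrite !addnA ltn_add2r !mulSn; lia.
Qed.

Lemma no_descent w : (forall i, i < n -> ~~ descent w i) -> w = 1%g.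
Proof.
move=> nd; have asc i : i < n -> label w i < label w i.+1.
  move=> lt_i; have := nd _ lt_i; rewrite /descent -leqNgt leq_eqVlt =>
    /predU1P[E|//].
  by have := label_inj (ltnW lt_i) lt_i E; lia.
have lo i : i <= n -> i <= label w i.
  by elim: i => // i IH lt_i; apply: leq_ltn_trans (asc _ lt_i); apply: IH;
    apply: ltnW.
have hi k : k <= n -> label w (n - k) <= n - k.
  elim: k => [_|k IH lt_k]; first by rewrite subn0 label_le.
  have := asc (n - k.+1); have -> : (n - k.+1).+1 = n - k by lia.
  by have := IH (ltnW lt_k); lia.
apply: label_ext => i le_i; rewrite label_1//; apply/eqP;
  rewrite eqn_leq lo// andbT.
by have := hi (n - i); rewrite subKn// leq_subr => ->.
Qed.

(** A prescription of v w from v (swap i w) for every descent i of w is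
    consistent as soon as it is so for two far apart descents and for two
    adjacent ones, which is the word problem of the symmetric group
    restricted to a lower ideal of the weak order. *)
Section Diamond.
Variables (T : Type) (x0 : T) (op : 'S_n.+1 -> nat -> T -> T) (admissible :
  pred 'S_n.+1).
Hypothesis admissible_desc : forall w i, admissible w -> i < n -> descent w i ->
  admissible (swap i w).
Hypothesis op_far : forall w i j x, admissible w -> i.+1 < j < n ->
  descent w i ->
  descent w j -> op w i (op (swap i w) j x) = op w j (op (swap j w) i x).
Hypothesis op_braid : forall w i x, admissible w -> i.+1 < n -> descent w i ->
  descent w i.+1 ->
  op w i (op (swap i w) i.+1 (op (swap i.+1 (swap i w)) i x))
    = op w i.+1 (op (swap i.+1 w) i (op (swap i (swap i.+1 w)) i.+1 x)).

(** Two descents of w lead to a common arrangement below both, through two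
    far apart swaps or the two sides of a braid relation; there v is already
    known to be consistent. *)
Lemma diamond_step k v w i j :
  (forall w i, disorder w < k -> admissible w -> i < n -> descent w i ->
    v w = op w i (v (swap i w))) ->
  disorder w <= k -> admissible w -> i < j < n -> descent w i -> descent w j ->
  op w i (v (swap i w)) = op w j (v (swap j w)).
Proof.
move=> vE le_k aw /andP[lt_ij lt_j] di dj; have lt_i := ltn_trans lt_ij lt_j.
have mi := disorder_swap lt_i di; have mj := disorder_swap lt_j dj.
have ai := admissible_desc aw lt_i di; have aj := admissible_desc aw lt_j dj.
case: (ltngtP i.+1 j) lt_ij => [far|gt|ji] lt_ij; [|lia|].
  have k1 := leq_trans mi le_k; have k1' := leq_trans mj le_k.
  rewrite (vE _ j k1) ?(vE _ i k1')//.
  - have ij : i.+1 < j < n by rewrite far.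
    by rewrite op_far// (swap_far w ij).
  - by rewrite /descent !label_swapn//; lia.
  - by rewrite /descent !label_swapn//; lia.
subst j.
have d1 : descent (swap i w) i.+1.
  by rewrite /descent label_swapr// label_swapn//; move: di dj;
    rewrite /descent; lia.
have d2 : descent (swap i.+1 (swap i w)) i.
  rewrite /descent label_swapl// (label_swapn (i := i.+1))//; try lia.
  rewrite label_swapl// label_swapn//; try lia; exact: dj.
have d1' : descent (swap i.+1 w) i.
  by rewrite /descent label_swapl// label_swapn//; move: di dj;
    rewrite /descent; lia.
have d2' : descent (swap i (swap i.+1 w)) i.+1.
  have -> : descent (swap i (swap i.+1 w)) i.+1 = descent w i; last exact: di.
  have ne : (i.+2 != i) && (i != i.+2) by lia.
  have ne1 : (i.+2 != i.+1) && (i != i.+1) by lia.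
  case/andP: ne ne1 => [ne ne'] /andP[ne1 ne1'].
  by rewrite /descent label_swapr// (label_swapn (i := i))// label_swapr//
    label_swapn// ltnW.
have a1 := admissible_desc ai lt_j d1; have a1' := admissible_desc aj lt_i d1'.
have m1 := disorder_swap lt_j d1; have m1' := disorder_swap lt_i d1'.
have k1 := leq_trans mi le_k; have k1' := leq_trans mj le_k.
have k2 := ltn_trans m1 k1; have k2' := ltn_trans m1' k1'.
rewrite (vE _ _ k1 ai lt_j d1) (vE _ _ k1' aj lt_i d1').
rewrite (vE _ _ k2 a1 lt_i d2) (vE _ _ k2' a1' lt_j d2').
by rewrite op_braid// (swap_braid w lt_j).
Qed.

(** By induction on k, v is defined on the arrangements of disorder less
    than k, with an arbitrary choice of descent at each step. *)
Lemma diamond : exists v : 'S_n.+1 -> T, v 1%g = x0 /\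
  forall w i, admissible w -> i < n -> descent w i ->
    v w = op w i (v (swap i w)).
Proof.
have below k : exists v : 'S_n.+1 -> T, v 1%g = x0 /\
    forall w i, disorder w < k -> admissible w -> i < n -> descent w i ->
      v w = op w i (v (swap i w)).
  elim: k => [|k [v [v1 vE]]]; first by exists (fun=> x0).
  pose v' w := if disorder w < k then v w else
    if [pick i : 'I_n | descent w i] is Some i then op w i (v (swap i w)) else
      x0.
  exists v'; split.
    rewrite /v'; case: ifP => // _; case: pickP => [i|//].
    by rewrite /descent (label_1 (ltn_ord i)) (label_1 (ltnW (ltn_ord i)))
      ltnNge leqnSn.
  move=> w i le_k aw lt_i di; rewrite ltnS in le_k.
  have -> : v' (swap i w) = v (swap i w).
    by rewrite /v' (leq_trans (disorder_swap lt_i di) le_k).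
  rewrite /v'; case: ifP => [lt_k|_]; first exact: vE.
  case: pickP => [j dj|/(_ (Ordinal lt_i))]; last by rewrite /= di.
  case: (ltngtP i j) => [lt_ij|lt_ji|->//].
    by rewrite -(@diamond_step k v w i j)// lt_ij /=.
  by rewrite (@diamond_step k v w j i)// lt_ji /=.
have [v [v1 vE]] := below (\max_w disorder w).+1.
by exists v; split=> // w i; apply: vE; rewrite ltnS; exact: leq_bigmax.
Qed.
End Diamond.
End Arrangements.

(** * Weight vectors generate minimal left ideals *)

Section Simplicity.
Variables (K : fieldType) (q : K) (n : nat) (A : algType K) (t : nat -> A).
Notation h := (q - q^-1).
Hypothesis q0 : q != 0.
Hypothesis q_gen : forall n, (0 < n)%N -> q ^+ n != 1.
Hypothesis tH : hecke_family q n t.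
Hypothesis t_gen : forall S : A -> Prop, S 1 ->
  (forall y z, S y -> S z -> S (y + z)) ->
  (forall a y, S y -> S (a *: y)) -> (forall k y, (k < n)%N -> S y ->
    S (t k * y)) ->
  forall y, S y.

Variables (sg : K -> K) (form : A -> A -> K).
Hypothesis sg_q : forall m : int, sg (q ^ m) = q ^ m.
Hypothesis formDr : forall y z1 z2, form y (z1 + z2) = form y z1 + form y z2.
Hypothesis formZr : forall a y z, form y (a *: z) = a * form y z.
Hypothesis formDl : forall y1 y2 z, form (y1 + y2) z = form y1 z + form y2 z.
Hypothesis formZl : forall a y z, form (a *: y) z = sg a * form y z.
Hypothesis form_t : forall k y z, (k < n)%N ->
  form (t k * y) z = form y (t k * z).
Hypothesis form_aniso : forall y, form y y = 0 -> y = 0.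

Lemma form_jm k y z : (k <= n)%N -> form (jm t k * y) z = form y (jm t k * z).
Proof.
elim: k y z => [|k IH] y z lt_k; first by rewrite !mul1r.
by rewrite /= -!mulrA form_t// IH 1?ltnW// form_t.
Qed.

(** The coefficient a of the intertwiner is the one with a * (x - x') = h *
    x'. *)
Lemma intertwiner i x x' y : (i < n)%N -> x != 0 -> x' != 0 -> x != x' ->
  jm t i * y = x *: y -> jm t i.+1 * y = x' *: y ->
  jm t i * (phi q t i x' x * y) = x' *: (phi q t i x' x * y) /\
  jm t i.+1 * (phi q t i x' x * y) = x *: (phi q t i x' x * y).
Proof.
move=> lt_i x0 x'0 xx' Ji Ji1.
have quad : t i * t i = 1 + h *: t i by case: tH => ->.
have xx0 : x - x' != 0 by rewrite subr_eq0.
rewrite /phi phi_coef//; set a := _ / _.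
have Jt : jm t i * (t i * y) = x' *: (t i * y) - (h * x') *: y.
  have : t i * (jm t i * (t i * y)) = x' *: y by rewrite !mulrA -/(jm t i.+1)
    Ji1.
  move/(congr1 (fun z => t i * z)); rewrite mulrA quad mulrDl mul1r -scalerAl.
  have -> : t i * (jm t i * (t i * y)) = x' *: y by rewrite !mulrA -/(jm t i.+1)
    Ji1.
  move=> E; rewrite scalerAr -E; lin_comb K; ring.
have ax : a * x = h * x' + a * x' by rewrite /a; move: (h) => c; field.
split.
  rewrite mulrDl -scalerAl mul1r mulrDr Jt -scalerAr Ji.
  by lin_comb K; ring: ax.
have t1 : t i * y + a *: y = t i * y + a%:A * y by rewrite -scalerAl mul1r.
rewrite mulrDl -scalerAl mul1r /= -!mulrA.
have -> : t i * (t i * y + a *: y) = y + (h + a) *: (t i * y).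
  by rewrite mulrDr mulrA quad mulrDl
    mul1r -scalerAl -scalerAr -addrA -scalerDl.
rewrite mulrDr Ji -scalerAr Jt mulrDr -!scalerAr mulrBr -!scalerAr mulrA quad.
rewrite mulrDl mul1r -scalerAl.
lin_comb K; ring: ax.
Qed.

Notation X := (fun m : int => q ^ (2 * m)).

Lemma X0 m : X m != 0. Proof. exact: expfz_neq0. Qed.
Lemma X_inj m m' : X m = X m' -> m = m'. Proof. exact: q_inj. Qed.

Lemma form_orth i m m' y z : (i <= n)%N -> m <> m' ->
  jm t i * y = X m *: y -> jm t i * z = X m' *: z -> form y z = 0.
Proof.
move=> le_i mm Jy Jz; have := form_jm y z le_i.
rewrite Jy Jz formZl formZr sg_q => /eqP; rewrite -subr_eq0 -mulrBl mulf_eq0.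
by rewrite subr_eq0 => /orP[/eqP/X_inj//|/eqP].
Qed.

(** Expanding jm t i * (t i * y) by jm t i.+1 = t i * jm t i * t i shows
    that jm t i is not diagonal on the span of y and t i * y;
    self-adjointness then gives h * X m * form y y = 0. *)
Lemma no_repeat i m y : (i < n)%N -> jm t i * y = X m *: y ->
  jm t i.+1 * y = X m *: y -> y = 0.
Proof.
move=> lt_i Ji Ji1; apply: form_aniso.
have quad : t i * t i = 1 + h *: t i by case: tH => ->.
have Jt : jm t i * (t i * y) = X m *: (t i * y) - (h * X m) *: y.
  have : t i * (jm t i * (t i * y)) = X m *: y by rewrite !mulrA -/(jm t i.+1)
    Ji1.
  move/(congr1 (fun z => t i * z)); rewrite mulrA quad mulrDl mul1r -scalerAl.
  have -> : t i * (jm t i * (t i * y)) = X m *: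
    y by rewrite !mulrA -/(jm t i.+1) Ji1.
  move=> E; rewrite scalerAr -E; lin_comb K; ring.
have := form_jm y (t i * y) (ltnW lt_i).
rewrite Ji Jt formZl sg_q formDr -scaleNr !formZr => /eqP.
rewrite eq_sym -subr_eq0 addrAC subrr add0r mulf_eq0 => /orP[|/eqP//].
rewrite oppr_eq0 mulf_eq0 (negPf (X0 m)) orbF => /eqP hh.
have /negP[] := q_gen (isT : 0 < 2)%N.
by have -> : q ^+ 2 = 1 + q * h by [field]; rewrite hh mulr0 addr0.
Qed.

(** The image u has a weight different from that of y, so it is orthogonal
    to y; since t i * u is a multiple of u by the quadratic relation, u is
    also orthogonal to itself. *)
Lemma adjacent_eigen i m m' y : (i < n)%N -> (m' = m + 1) \/ (m' = m - 1) ->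
  jm t i * y = X m *: y -> jm t i.+1 * y = X m' *: y ->
  phi q t i (X m') (X m) * y = 0.
Proof.
move=> lt_i mm Ji Ji1; set u := _ * y; apply: form_aniso.
have nm : m <> m' by case: mm; lia.
have xx : X m != X m' by apply/eqP => /X_inj.
have [Ju _] := intertwiner lt_i (X0 m) (X0 m') xx Ji Ji1.
have yu : form y u = 0 by apply: form_orth (ltnW lt_i) nm Ji Ju.
have quad : t i * t i = 1 + h *: t i by case: tH => ->.
have [a aE aa] : exists2 a, phi q t i (X m') (X m) = t i + a%:A & a * a =
  1 - a * h.
  rewrite /phi phi_coef ?X0//; last by rewrite subr_eq0.
  eexists; first by [].
  have x0 := X0 m; have q21 : q ^+ 2 - 1 != 0 by rewrite subr_eq0 q_gen.
  have {mm} : X m' = X m * q ^+ 2 \/ X m' = X m / q ^+ 2.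
    by case: mm => ->; [left|right]; rewrite mulrDr expfzDr.
  have q21' : 1 - q ^+ 2 != 0 by rewrite -opprB oppr_eq0.
  case=> ->; move: (X m) x0 => x x0; field.
    by rewrite q0 -[X in X - _]mulr1 -mulrBr mulf_neq0.
  by rewrite q0 -[X in _ - X]mulr1 -mulrBr mulf_neq0.
have [b ub] : exists b, t i * u = b *: u.
  exists (h + a); rewrite /u aE mulrA mulrDr quad -scalerAr mulr1 !mulrDl
    !mul1r -!scalerAl !mul1r.
  lin_comb K; ring: aa.
rewrite {1}/u aE mulrDl -scalerAl mul1r formDl formZl form_t// ub formZr.
by rewrite yu !mulr0 addr0.
Qed.

Variables (F : A) (c : nat -> int).
Hypothesis FX : forall k, (k <= n)%N -> jm t k * F = X (c k) *: F.

Implicit Types (w : 'S_n.+1) (i j k : nat).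

Definition far_apart a b := (1 < absz (c a - c b))%N.

(** Labels with contents at distance at most one are never inverted. For the
    contents of a tableau these arrangements are the standard tableaux of
    the same shape. *)
Definition admissible w := [forall i : 'I_n.+1, forall j : 'I_n.+1,
  (i < j)%N && (w j < w i)%N ==> far_apart (w i) (w j)].

Lemma admissibleP w : reflect (forall i j, (i < j)%N -> (j <= n)%N ->
  (label w j < label w i)%N ->
  far_apart (label w i) (label w j)) (admissible w).
Proof.
apply: (iffP forallP) => [H i j lt_ij le_j inv|H i].
  have /forallP/(_ (inord j)) := H (inord i).
  by rewrite !inordK ?ltnS//; [rewrite lt_ij => /implyP; apply|lia].
apply/forallP => j; apply/implyP => /andP[lt_ij inv].
have := H i j lt_ij; rewrite /label !inord_val; apply=> //; rewrite -ltnS;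
  exact: ltn_ord.
Qed.

Lemma far_apartC a b : far_apart a b = far_apart b a.
Proof. by rewrite /far_apart; lia. Qed.

Lemma admissible_swap w i : admissible w -> (i < n)%N ->
  descent w i \/ far_apart (label w i) (label w i.+1) -> admissible (swap i w).
Proof.
move=> /admissibleP aw lt_i di; apply/admissibleP => p r lt_pr le_r.
have le_p : (p <= n)%N by lia.
rewrite !label_swap//.
have [/andP[/eqP-> /eqP->]|pr] := boolP ((p == i) && (r == i.+1)).
  rewrite {1 2}/swap_pos eqxx ifN ?eqxx; last by lia.
  rewrite /swap_pos eqxx ifN ?eqxx; last by lia.
  by case: di; [rewrite /descent; lia|rewrite far_apartC].
apply: aw; last exact: swap_pos_le.
by move: pr; rewrite /swap_pos; case_ifs; lia.
Qed.

Lemma admissible_desc w i : admissible w -> (i < n)%N -> descent w i ->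
  admissible (swap i w).
Proof. by move=> aw lt_i di; apply: admissible_swap => //; left. Qed.

Lemma admissible1 : admissible 1%g.
Proof.
apply/admissibleP => i j lt_ij le_j; rewrite !label_1//; lia.
Qed.

Definition weight w k := X (c (label w k)).
Definition op w i (y : A) : A := phi q t i (weight w i) (weight w i.+1) * y.

Lemma far_weight w i j : far_apart (label w i) (label w j) ->
  weight w i != weight w j.
Proof. by move=> f; apply/eqP => /X_inj E; move: f;
  rewrite /far_apart E subrr. Qed.

Lemma op_far w i j x : admissible w -> (i.+1 < j < n)%N -> descent w i ->
  descent w j -> op w i (op (swap i w) j x) = op w j (op (swap j w) i x).
Proof.
move=> aw /andP[ij lt_j] di dj; rewrite /op !mulrA; congr (_ * _).
rewrite /weight !label_swapn//; try lia.
have tij : GRing.comm (t i) (t j) by apply: (hecke_far tH) => //; lia.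
by apply/comm_phi/commr_sym/comm_phi/commr_sym.
Qed.

Lemma op_braid w i x : admissible w -> (i.+1 < n)%N -> descent w i ->
  descent w i.+1 ->
  op w i (op (swap i w) i.+1 (op (swap i.+1 (swap i w)) i x))
    = op w i.+1 (op (swap i.+1 w) i (op (swap i (swap i.+1 w)) i.+1 x)).
Proof.
move=> aw lt_i di dj; have lt_i' := ltnW lt_i.
have e1 (u : 'S_n.+1) : label (swap i u) i.+2 = label u i.+2.
  by apply: label_swapn => //; apply/eqP; lia.
have e2 (u : 'S_n.+1) : label (swap i.+1 u) i = label u i.
  by apply: label_swapn; lia.
rewrite /op !mulrA; congr (_ * _); rewrite /weight.
rewrite !(label_swapl _ lt_i', label_swapr _ lt_i', label_swapl _ lt_i,
  label_swapr _ lt_i, e1, e2).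
have inv := elimT (admissibleP w) aw.
rewrite (yang_baxter tH)//; first by rewrite !X0.
split; apply: far_weight; apply: inv; rewrite ?leqnSn//.
by move: di dj; rewrite /descent; lia.
Qed.

Definition has_weight w y := forall k, (k <= n)%N -> jm t k * y = weight w k *:
  y.

Lemma weight_swap w i y : (i < n)%N -> weight w i != weight w i.+1 ->
  has_weight w y -> has_weight (swap i w)
    (phi q t i (weight w i.+1) (weight w i) * y).
Proof.
move=> lt_i ne wy k le_k.
have [J1 J2] := intertwiner lt_i (X0 _) (X0 _) ne (wy i (ltnW lt_i))
  (wy i.+1 lt_i).
have [->|ki] := eqVneq k i; first by rewrite /weight label_swapl.
have [->|ki1] := eqVneq k i.+1; first by rewrite /weight label_swapr.
have cm : GRing.comm (jm t k) (phi q t i (weight w i.+1) (weight w i)).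
  apply: comm_phi; case: (ltnP k i) => [lt_k|le_i].
    by apply/commr_sym/comm_jm => j lt_j; apply: (hecke_far tH) => //; lia.
  by apply/commr_sym/(jm_comm tH) => //; lia.
by rewrite /weight label_swapn// mulrA cm -mulrA wy// -scalerAr.
Qed.

Lemma phi_unitary i x y : (i < n)%N -> x != 0 -> y != 0 -> x != y ->
  phi q t i x y * phi q t i y x
    = ((x - q ^+ 2 * y) * (x - q ^- 2 * y) / (x - y) ^+ 2)%:A.
Proof.
move=> lt_i x0 y0 xy.
have quad : t i * t i = 1 + h *: t i by case: tH => ->.
have xy0 : x - y != 0 by rewrite subr_eq0.
have yx0 : y - x != 0 by rewrite -opprB oppr_eq0.
rewrite /phi !phi_coef//.
have E : h * y / (x - y) = - h - h * x / (y - x).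
  by move: (h) => d; field; rewrite ?xy0 ?yx0.
have E2 : (x - q ^+ 2 * y) * (x - q ^- 2 * y) / (x - y) ^+ 2
    = 1 + h * x / (y - x) * (h * y / (x - y)).
  by field; rewrite ?q0 ?xy0 ?yx0.
rewrite {}E2; set a := h * x / _ in E *; set b := h * y / _ in E *.
clearbody a b; rewrite !algE quad; lin_comb K; rewrite ?E; ring.
Qed.

Lemma phi_unitary_neq0 a b : far_apart a b ->
  (X (c a) - q ^+ 2 * X (c b)) * (X (c a) - q ^- 2 * X (c b)) /
    (X (c a) - X (c b)) ^+ 2 != 0.
Proof.
rewrite /far_apart => f.
have E1 : q ^+ 2 * X (c b) = X (c b + 1) by rewrite mulrDr expfzDr// mulrC.
have E2 : q ^- 2 * X (c b) = X (c b - 1) by rewrite mulrBr expfzDr// mulrC.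
rewrite E1 E2 !mulf_neq0 ?invr_eq0 ?expf_neq0// subr_eq0; apply/eqP => /X_inj E;
  by move: f; rewrite E; lia.
Qed.

Section Vectors.
Variable v : 'S_n.+1 -> A.
Hypothesis v1 : v 1%g = F.
Hypothesis vE : forall w i, admissible w -> (i < n)%N -> descent w i ->
  v w = op w i (v (swap i w)).

Lemma descent_ind (P : 'S_n.+1 -> Prop) : P 1%g ->
  (forall w i, admissible w -> (i < n)%N -> descent w i -> P (swap i w) ->
    P w) ->
  forall w, admissible w -> P w.
Proof.
move=> P1 Pd w; move: {2}(disorder w).+1 (ltnSn (disorder w)) => k.
elim: k w => // k IH w; rewrite ltnS => le_k aw.
have [/existsP[i di]|/existsPn nd] := boolP [exists i : 'I_n, descent w i].
  apply: (Pd w i) => //; apply: IH; last exact: admissible_desc.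
  by apply: leq_trans le_k; exact: disorder_swap.
by rewrite (@no_descent _ w)// => i lt_i; exact: (nd (Ordinal lt_i)).
Qed.

Lemma descent_far w i : admissible w -> (i < n)%N -> descent w i ->
  far_apart (label w i) (label w i.+1).
Proof. by move=> /admissibleP aw lt_i di; apply: aw. Qed.

Lemma v_weight w : admissible w -> has_weight w (v w).
Proof.
move: w; apply: descent_ind => [k le_k|w i aw lt_i di IH].
  by rewrite v1 /weight label_1// FX.
rewrite (vE aw lt_i di) /op -{1}(swapK i w).
have wi : weight w i = weight (swap i w) i.+1 by rewrite /weight label_swapr.
have wi1 : weight w i.+1 = weight (swap i w) i by rewrite /weight label_swapl.
rewrite wi wi1; apply: weight_swap => //; rewrite -wi -wi1 eq_sym.
exact/far_weight/descent_far.
Qed.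

Definition weight_vec w : A := if admissible w then v w else 0.

Lemma phi_weight_vec w i : admissible w -> (i < n)%N -> descent w i ->
  exists2 s, s != 0 & phi q t i (weight w i.+1) (weight w i) * weight_vec w =
    s *: weight_vec (swap i w).
Proof.
move=> aw lt_i di; have f := descent_far aw lt_i di.
rewrite /weight_vec aw (admissible_desc aw)// (vE aw lt_i di) /op mulrA.
rewrite phi_unitary ?X0//; last by rewrite eq_sym far_weight.
rewrite -scalerAl mul1r; eexists; last by [].
by apply: phi_unitary_neq0; rewrite far_apartC.
Qed.

(** If i is a descent or the labels at i, i.+1 are far apart, t i differs
    from an intertwiner to swap i w by a scalar; otherwise [no_repeat] or
    [adjacent_eigen] applies. *)
Lemma t_weight_vec w i : (i < n)%N ->
  exists a b, t i * weight_vec w = a *: weight_vec w + b *: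
    weight_vec (swap i w).
Proof.
move=> lt_i; have [aw|naw] := boolP (admissible w); last first.
  by exists 0, 0; rewrite /weight_vec (negPf naw) mulr0 !scale0r addr0.
have phiE x y (z z' : A) : phi q t i x y * z = z' ->
    t i * z = - (h / (x^-1 * y - 1)) *: z + z'.
  by move=> <-; rewrite /phi; set a := h / _; rewrite mulrDl -scalerAl mul1r;
    lin_comb K; ring.
have [di|asc] := boolP (descent w i).
  have [s _ /phiE ->] := phi_weight_vec aw lt_i di.
  by eexists; eexists.
have wv := v_weight aw.
have [f|nf] := boolP (far_apart (label w i) (label w i.+1)).
  have am : admissible (swap i w) by apply: admissible_swap => //; right.
  have dm : descent (swap i w) i.
    rewrite /descent label_swapl// label_swapr//; move: asc;
      rewrite /descent -leqNgt leq_eqVlt.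
    by case/predU1P => // /(label_inj (ltnW lt_i) lt_i); lia.
  have := vE am lt_i dm; rewrite swapK /op => /esym/phiE.
  rewrite /weight_vec aw am => ->; eexists; exists 1; rewrite scale1r; by [].
have wi := wv i (ltnW lt_i); have wi1 := wv i.+1 lt_i.
have [cc|cc] := eqVneq (c (label w i)) (c (label w i.+1)).
  exists 0, 0; rewrite /weight_vec aw (@no_repeat i (c (label w i)) (v w))//.
    by rewrite mulr0 !scale0r addr0.
  by rewrite wi1 /weight cc.
have : phi q t i (weight w i.+1) (weight w i) * v w = 0.
  by apply: adjacent_eigen => //; move: nf cc; rewrite /far_apart; lia.
move/phiE => E; rewrite {1 2}/weight_vec aw E; eexists; exists 0.
by rewrite scale0r.
Qed.

Definition in_span (y : A) := exists al : 'S_n.+1 -> K, y = \sum_w al w *: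
  weight_vec w.

Lemma in_span_weight_vec w : in_span (weight_vec w).
Proof.
exists (fun w' => (w' == w)%:R);
  rewrite (bigD1 w)//= eqxx scale1r big1 ?addr0//.
by move=> w' /negPf ->; rewrite scale0r.
Qed.

Lemma in_spanD y z : in_span y -> in_span z -> in_span (y + z).
Proof.
move=> [a ->] [b ->]; exists (fun w => a w + b w); rewrite -big_split /=.
by apply: eq_bigr => w _; rewrite scalerDl.
Qed.

Lemma in_spanZ a y : in_span y -> in_span (a *: y).
Proof.
move=> [b ->]; exists (fun w => a * b w); rewrite scaler_sumr.
by apply: eq_bigr => w _; rewrite scalerA.
Qed.

Lemma in_span_t i y : (i < n)%N -> in_span y -> in_span (t i * y).
Proof.
move=> lt_i [a ->]; rewrite mulr_sumr.
apply: big_ind => [||w _]; first by exists (fun=> 0); rewrite big1// => w _;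
  rewrite scale0r.
  exact: in_spanD.
rewrite -scalerAr; apply: in_spanZ; have [b [b' ->]] := t_weight_vec w lt_i.
by apply: in_spanD; apply: in_spanZ; exact: in_span_weight_vec.
Qed.

Lemma left_ideal_span y : in_span (y * F).
Proof.
move: y; apply: t_gen => [|y z Sy Sz|a y Sy|k y lt_k Sy].
- by have := in_span_weight_vec 1%g; rewrite /weight_vec admissible1 v1 mul1r.
- by rewrite mulrDl; exact: in_spanD.
- by rewrite -scalerAl; exact: in_spanZ.
- by rewrite -mulrA; exact: in_span_t.
Qed.

(** Labels with the same content keep their order in admissible
    arrangements. At the first place where w and w' differ, the smaller of
    the two labels would have to come later in the other arrangement. *)
Lemma weights_separate w w' : admissible w -> admissible w' ->
  (forall k, (k <= n)%N -> weight w k = weight w' k) -> w = w'.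
Proof.
move=> aw aw' E.
have aux (u u' : 'S_n.+1) k : admissible u -> admissible u' -> (k <= n)%N ->
    (forall j, (j < k)%N -> label u j = label u' j) ->
      c (label u k) = c (label u' k) ->
    ~~ (label u k < label u' k)%N.
  move=> au au' le_k Ek ck; apply/negP => lt_k.
  have [r le_r rE] := label_surj u' (label_le u k).
  case: (ltngtP r k) => [lt_r|gt_r|rk].
  - have := Ek r lt_r; rewrite rE => /(label_inj le_r le_k); lia.
  - have := elimT (admissibleP u') au' k r gt_r le_r; rewrite rE => /(_ lt_k).
    by rewrite /far_apart ck subrr.
  - by move: lt_k; rewrite -rE rk ltnn.
apply: label_ext => k; elim/ltn_ind: k => k IH le_k.
have ck : c (label w k) = c (label w' k) by apply/X_inj/E.
have Ek j : (j < k)%N -> label w j = label w' j by move=> lt_j; apply: IH; lia.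
have /negP := aux w w' k aw aw' le_k Ek ck.
have /negP := aux w' w k aw' aw le_k (fun j lt => esym (Ek j lt)) (esym ck).
by lia.
Qed.

(** A product of factors jm t k - x, one for each other arrangement, acts on
    each weight vector by a scalar. *)
Lemma projector w0 : admissible w0 -> exists p : A, exists2 s, s != 0 &
  forall w, p * weight_vec w = (if w == w0 then s else 0) *: weight_vec w.
Proof.
move=> aw0.
have sep w : exists k, [&& admissible w & w != w0] -> (k <= n)%N /\
  weight w k != weight w0 k.
  have [/andP[aw ne]|_] := boolP (_ && _); last by exists 0%N.
  apply: contrapT => nex; case/eqP: ne; apply: weights_separate => // k le_k.
  by apply/eqP; apply: contra_notT nex => ?; exists k.
have [f fE] := choice sep.
pose p := \prod_(w | admissible w && (w != w0))
  (jm t (f w) - (weight w (f w))%:A).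
have act w' : admissible w' -> p * weight_vec w' =
    (\prod_(w | admissible w && (w != w0)) (weight w' (f w) - weight w (f w)))
      *: weight_vec w'.
  move=> aw'; rewrite /p; elim/big_rec2: _ => [|w y1 y2 /fE[le_f _] IH].
    by rewrite mul1r scale1r.
  rewrite -mulrA IH -scalerAr mulrBl -scalerAl mul1r /weight_vec aw'
    v_weight// -scalerBl scalerA.
  by rewrite mulrC.
exists p; exists (\prod_(w | admissible w && (w != w0))
  (weight w0 (f w) - weight w (f w))).
  by apply/prodf_neq0 => w /fE[_ ne]; rewrite subr_eq0 eq_sym.
move=> w; have [aw|naw] := boolP (admissible w); last first.
  by rewrite /weight_vec (negPf naw) mulr0 scaler0.
rewrite act//; case: eqVneq => [->//|ne]; congr (_ *: _).
by rewrite (bigD1 w) ?aw//= subrr mul0r.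
Qed.

Lemma left_ideal_minimal (W : A -> Prop) y :
  (forall a z, W z -> W (a * z)) -> W (y * F) -> y * F <> 0 -> W F.
Proof.
move=> WM Wy y0; have [al yE] := left_ideal_span y.
have WZ a z : W z -> W (a *: z) by move=> Wz;
  rewrite -[a *: z]mul1r -scalerAr scalerAl; exact: WM.
have [w0 nz] : exists w0, al w0 *: weight_vec w0 <> 0.
  apply: contrapT => nex; case: y0; rewrite yE big1// => w _.
  by apply: contrapT => ?; apply: nex; exists w.
have aw0 : admissible w0.
  by apply: contraPT nz => /negPf E; rewrite /weight_vec E scaler0.
(* The component of y * F at an arrangement where it does not vanish. *)
have [p [s s0 pE]] := projector aw0.
have Ww0 : W (weight_vec w0).
  have := WM p _ Wy; rewrite yE mulr_sumr (bigD1 w0)//= big1 ?addr0 => [|w ne].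
    rewrite -scalerAr pE eqxx scalerA => /(WZ (al w0 * s)^-1).
    rewrite scalerA mulVf ?scale1r// mulf_neq0//.
    by apply: contraPneq nz => ->; rewrite scale0r.
  by rewrite -scalerAr pE (negPf ne) scale0r scaler0.
suff H w : admissible w -> W (weight_vec w) -> W F by exact: H Ww0.
move: w; apply: descent_ind => [|w i aw lt_i di IH Ww].
  by rewrite /weight_vec admissible1 v1.
apply: IH; have [r r0 E] := phi_weight_vec aw lt_i di.
have := WM (phi q t i (weight w i.+1) (weight w i)) _ Ww.
by rewrite E => /(WZ r^-1); rewrite scalerA mulVf// scale1r.
Qed.
End Vectors.

Theorem weight_vector_minimal (W : A -> Prop) y :
  (forall a z, W z -> W (a * z)) -> W (y * F) -> y * F <> 0 -> W F.
Proof.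
have [v [v1 vE]] := diamond F admissible_desc op_far op_braid.
exact: left_ideal_minimal v1 vE W y.
Qed.

End Simplicity.

(** * The regular representation *)

(** The algebras are kept abstract, so that the laws of the morphism f apply
    without unfolding a quotient. *)
Section Morphisms.
Variables (K : fieldType) (B C : lalgType K) (f : B -> C).
Hypotheses (fB : {morph f : x y / x - y}) (fD : {morph f : x y / x + y}).
Hypotheses (fM : {morph f : x y / x * y}) (fZ : forall a,
  {morph f : x / a *: x}).
Hypothesis f1 : f 1 = 1.

Lemma morph_braid x y : f (x * y * x - y * x * y) = f x * f y * f x - f y *
  f x * f y.
Proof. by rewrite fB !fM. Qed.

Lemma morph_commute x y : f (x * y - y * x) = f x * f y - f y * f x.
Proof. by rewrite fB !fM. Qed.

Lemma morph_quad c d x : f ((x - c%:A) * (x + d%:A)) = (f x - c%:A) *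
  (f x + d%:A).
Proof. by rewrite fM fB fD !fZ f1. Qed.
End Morphisms.

Lemma quadratic_relation (K : fieldType) (A : algType K) (q : K) (T : A) :
  q != 0 ->
  (T - q%:A) * (T + q^-1%:A) = 0 -> T * T = 1 + (q - q^-1) *: T.
Proof.
move=> q0; rewrite mulrBl !mulrDr -!scalerAr -!scalerAl !mulr1 mul1r => E.
by apply/eqP; rewrite -subr_eq0 -[X in _ == X]E; apply/eqP; lin_comb K;
  by field.
Qed.

Section RegularRepresentation.
Import finmap monalg.
Variables (K : fieldType) (q : K) (n : nat).
Notation h := (q - q^-1).
Notation perm := ('S_n.+1).
Implicit Types (w : perm) (f g : perm -> K).

(** The matrix of T_k on the basis T_w, which is symmetric: T_k maps T_w to
    T_(swap k w), plus h T_w if k is a descent of w. *)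
Definition reg_op (k : nat) f w : K :=
  f (swap k w) + (if descent w k then h * f w else 0).

Lemma reg_op_quad k f w : (k < n)%N -> reg_op k (reg_op k f) w = f w + h *
  reg_op k f w.
Proof.
move=> lt_k; rewrite /reg_op swapK descent_swap//; case: (descent w k) => /=;
  ring.
Qed.

Lemma reg_op_far i j f w : (i.+1 < j < n)%N -> reg_op i (reg_op j f) w =
  reg_op j (reg_op i f) w.
Proof.
move=> ij; have /andP[lt_ij lt_j] := ij.
rewrite /reg_op (swap_far _ ij).
have -> : descent (swap i w) j = descent w j by rewrite /descent !label_swapn//;
  lia.
have -> : descent (swap j w) i = descent w i by rewrite /descent !label_swapn//;
  lia.
by case: (descent w i); case: (descent w j); ring.
Qed.

(** After expansion only the relative order of three labels matters, in six
    cases. *)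
Lemma reg_op_braid k f w : (k.+1 < n)%N ->
  reg_op k (reg_op k.+1 (reg_op k f)) w = reg_op k.+1 (reg_op k (reg_op k.+1 f))
    w.
Proof.
move=> lt_k; have lt_k' := ltnW lt_k.
have e1 (u : perm) : label (swap k u) k.+2 = label u k.+2 by apply: label_swapn;
  lia.
have e2 (u : perm) : label (swap k.+1 u) k = label u k by apply: label_swapn;
  lia.
have l1 := @label_swapl n k _ lt_k'; have r1 := @label_swapr n k _ lt_k'.
have l2 := @label_swapl n k.+1 _ lt_k; have r2 := @label_swapr n k.+1 _ lt_k.
have ne1 : label w k <> label w k.+1 by move/(label_inj (ltnW lt_k') lt_k');
  lia.
have ne2 : label w k <> label w k.+2 by move/(label_inj (ltnW lt_k') lt_k); lia.
have ne3 : label w k.+1 <> label w k.+2 by move/(label_inj lt_k' lt_k); lia.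
rewrite /reg_op !swapK swap_braid// /descent !(l1, r1, l2, r2, e1, e2).
move: (f _) (f _) (f _) (f _) (f _) (f _) => f1 f2 f3 f4 f5 f6.
case: (ltngtP (label w k) (label w k.+1)) => // h1;
case: (ltngtP (label w k) (label w k.+2)) => // h2;
case: (ltngtP (label w k.+1) (label w k.+2)) => // h3; try ring; exfalso; lia.
Qed.

Lemma reg_op_addZ k d f g w :
  reg_op k (fun w => f w + d * g w) w = reg_op k f w + d * reg_op k g w.
Proof. by rewrite /reg_op; case: ifP => _; ring. Qed.

Local Notation free_alg := {malg K[{fmonom 'I_n}]}.

Definition word_act (s : seq 'I_n) f : perm -> K :=
  foldr (fun (i : 'I_n) g => reg_op i g) f s.
Definition free_act (x : free_alg) f w : K :=
  monalg.mmap idfun (fun m : {fmonom 'I_n} => word_act m f w) x.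

Lemma free_actD x y f w : free_act (x + y) f w = free_act x f w +
  free_act y f w.
Proof. exact: monalg.mmapD. Qed.
Lemma free_actB x y f w : free_act (x - y) f w = free_act x f w - free_act y f
  w.
Proof. exact: monalg.mmapB. Qed.
Lemma free_actU c m f w : free_act << c *g m >> f w = c * word_act m f w.
Proof. exact: monalg.mmapU. Qed.
Lemma free_act_sum (I : Type) (r : seq I) (x : I -> free_alg) f w :
  free_act (\sum_(i <- r) x i) f w = \sum_(i <- r) free_act (x i) f w.
Proof. exact: (raddf_sum (monalg.mmap idfun (fun m : {fmonom 'I_n} =>
  word_act m f w))). Qed.

Lemma reg_op_lin k (I : Type) (r : seq I) (b : I -> K) (F : I -> perm -> K) w :
  reg_op k (fun w => \sum_(i <- r) b i * F i w) w = \sum_(i <- r) b i *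
    reg_op k (F i) w.
Proof.
rewrite /reg_op; case: ifP => _; last by under [RHS]eq_bigr do rewrite addr0;
  rewrite addr0.
rewrite mulr_sumr -big_split /=; apply: eq_bigr => i _; ring.
Qed.

Lemma word_act_lin s (I : Type) (r : seq I) (b : I -> K) (F : I -> perm ->
  K) w :
  word_act s (fun w => \sum_(i <- r) b i * F i w) w = \sum_(i <- r) b i *
    word_act s (F i) w.
Proof.
elim: s w => //= i s IH w.
have -> : word_act s (fun w => \sum_(i <- r) b i * F i w)
   = fun w => \sum_(i <- r) b i * word_act s (F i) w by apply/funext.
by rewrite reg_op_lin.
Qed.

Lemma word_act_cat s1 s2 f : word_act (s1 ++ s2) f =
  word_act s1 (word_act s2 f).
Proof. by rewrite /word_act foldr_cat. Qed.

Lemma free_actM x y f w : free_act (x * y) f w = free_act x (free_act y f) w.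
Proof.
rewrite malgME free_act_sum [RHS]/free_act monalg.mmapE; apply: eq_bigr => k _.
have yE : free_act y f = fun w => \sum_(m <- enum_fset (msupp y)) y@_m *
  word_act m f w.
  by apply/funext => w'; rewrite /free_act monalg.mmapE.
rewrite yE word_act_lin free_act_sum mulr_sumr; apply: eq_bigr => m _.
by rewrite free_actU fmM word_act_cat /= mulrA.
Qed.

Lemma free_act_letter i f w : free_act (letter K (l := n.+1) i) f w =
  reg_op i f w.
Proof. by rewrite free_actU mul1r fmU. Qed.

Lemma free_act_scale c x f w : free_act (c *: x) f w = c * free_act x f w.
Proof.
rewrite -mul_malgC free_actM free_actU fm1 /=; congr (_ * _).
Qed.

Lemma free_act1 f w : free_act 1 f w = f w.
Proof. by rewrite free_actU fm1 mul1r. Qed.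

Lemma free_act0 x w : free_act x (fun=> 0) w = 0.
Proof.
have E s : word_act s (fun=> 0) = fun=> 0.
  elim: s => //= i s ->; apply/funext => w'; rewrite /reg_op; case: ifP => _;
    ring.
by rewrite /free_act monalg.mmapE big1// => m _; rewrite E mulr0.
Qed.

Section Relators.
Variables (x y : free_alg) (a b : (perm -> K) -> perm -> K).
Hypotheses (xa : forall g, free_act x g = a g) (yb : forall g, free_act y g =
  b g).

Lemma free_act_braid f w : free_act (x * y * x - y * x * y) f w =
  a (b (a f)) w - b (a (b f)) w.
Proof.
apply: (etrans (free_actB (x * y * x) (y * x * y) f w)).
have E1 : free_act (x * y * x) f w = a (b (a f)) w.
  by apply: (etrans (free_actM (x * y) x f w));
    apply: (etrans (free_actM x y _ w)); rewrite !(xa, yb).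
have E2 : free_act (y * x * y) f w = b (a (b f)) w.
  by apply: (etrans (free_actM (y * x) y f w));
    apply: (etrans (free_actM y x _ w)); rewrite !(xa, yb).
exact: (congr2 (fun u v => u - v) E1 E2).
Qed.

Lemma free_act_commute f w : free_act (x * y - y * x) f w = a (b f) w - b (a f)
  w.
Proof.
apply: (etrans (free_actB (x * y) (y * x) f w)).
have E1 : free_act (x * y) f w = a (b f) w.
  by apply: (etrans (free_actM x y f w)); rewrite !(xa, yb).
have E2 : free_act (y * x) f w = b (a f) w.
  by apply: (etrans (free_actM y x f w)); rewrite !(xa, yb).
exact: (congr2 (fun u v => u - v) E1 E2).
Qed.

Lemma free_act_quad (c d : K) f w :
  free_act ((x - c%:A) * (x + d%:A)) f w
    = a (fun w => a f w + d * f w) w - c * (a f w + d * f w).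
Proof.
apply: (etrans (free_actM (x - c%:A) (x + d%:A) f w)).
have -> : free_act (x + d%:A) f = fun w => a f w + d * f w.
  apply/funext => w'; apply: (etrans (free_actD x d%:A f w')).
  by rewrite xa (free_act_scale d 1) free_act1.
apply: (etrans (free_actB x c%:A _ w)).
by rewrite xa (free_act_scale c 1) free_act1.
Qed.
End Relators.

Lemma free_act_gen i g : free_act (letter K (l := n.+1) i) g = reg_op i g.
Proof. by apply/funext => w; exact: free_act_letter. Qed.

Hypothesis q0 : q != 0.

(** The relators act by zero because reg_op satisfies the Hecke relations. *)
Lemma free_act_ideal x f w : hecke_ideal_gen q (l := n.+1) x ->
  free_act x f w = 0.
Proof.
move=> xI; elim: {x} xI f w => [x xR||x y _ IHx _ IHy|a x _ IH|a x _ IH] f w.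
- case: x / xR => [i|i j ji|i j ij].
  + rewrite (free_act_quad (free_act_gen i)).
    have -> : reg_op i (fun w => reg_op i f w + q^-1 * f w) w
        = f w + h * reg_op i f w + q^-1 * reg_op i f w.
      rewrite -(reg_op_quad f w (ltn_ord i : (i < n)%N)).
      exact: reg_op_addZ.
    by field.
  + rewrite (free_act_braid (free_act_gen i) (free_act_gen j)) ji reg_op_braid
    ?subrr//.
    by rewrite -ji; exact: (ltn_ord j).
  + rewrite (free_act_commute (free_act_gen i) (free_act_gen j));
    case/orP: ij => ij.
      by rewrite reg_op_far ?subrr// ij (ltn_ord j).
    by rewrite -reg_op_far ?subrr// ij (ltn_ord i).
- exact: monalg.mmap0.
- by apply: (etrans (free_actB x y f w)); rewrite IHx IHy subrr.
- have E : free_act x f = fun=> 0 by apply/funext => w'; exact: IH.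
  by apply: (etrans (free_actM a x f w)); rewrite E free_act0.
- by apply: (etrans (free_actM x a f w)); rewrite IH.
Qed.

Definition hecke_act (y : hecke q n.+1) f w : K := free_act (repr y) f w.

Lemma hecke_act_pi x f w : hecke_act (hecke_pi q x) f w = free_act x f w.
Proof.
apply/eqP; rewrite -subr_eq0 -free_actB; apply/eqP/free_act_ideal.
by apply/asboolP; exact: hecke_repr.
Qed.

Lemma hecke_actM y z f w : hecke_act (y * z) f w = hecke_act y (hecke_act z f)
  w.
Proof.
have [[x ->] [x' ->]] := (hecke_piP y, hecke_piP z).
rewrite -hecke_piM !hecke_act_pi free_actM; congr (free_act x _ w).
by apply/funext => w'; rewrite hecke_act_pi.
Qed.

Lemma hecke_actD y z f w : hecke_act (y + z) f w = hecke_act y f w +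
  hecke_act z f w.
Proof.
have [[x ->] [x' ->]] := (hecke_piP y, hecke_piP z).
by rewrite -hecke_piD !hecke_act_pi free_actD.
Qed.

Lemma hecke_actZ c y f w : hecke_act (c *: y) f w = c * hecke_act y f w.
Proof.
have [x ->] := hecke_piP y.
by rewrite -hecke_piZ !hecke_act_pi free_act_scale.
Qed.

Lemma hecke_act1 f w : hecke_act 1 f w = f w.
Proof. by rewrite hecke_act_pi free_act1. Qed.

Definition hecke_gen (k : nat) : hecke q n.+1 := hecke_T q n.+1 k.+1.

Lemma hecke_genE k (lt_k : (k < n)%N) :
  hecke_gen k = hecke_pi q (letter K (l := n.+1) (Ordinal lt_k)).
Proof. by rewrite /hecke_gen /hecke_T /= insubT. Qed.

Lemma hecke_act_gen k f w : (k < n)%N -> hecke_act (hecke_gen k) f w =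
  reg_op k f w.
Proof. by move=> lt_k; rewrite hecke_genE hecke_act_pi free_act_letter. Qed.

Lemma hecke_pi0 x : hecke_ideal_gen q (l := n.+1) x -> hecke_pi q x = 0.
Proof.
move=> xI; have -> : 0 = @hecke_pi K q n.+1 0.
  by rewrite -[in RHS](subrr 0) hecke_piB subrr.
by apply/eqP; rewrite hecke_pi_eq subr0; apply/asboolP.
Qed.

Lemma hecke_family_gen : hecke_family q n hecke_gen.
Proof.
have pB := @hecke_piB K q n.+1; have pM := @hecke_piM K q n.+1.
have rel x : hecke_relator q (l := n.+1) x -> hecke_pi q x = 0.
  by move=> xr; apply/hecke_pi0/HeckeIdealRel.
split=> [k lt_k|k lt_k|i j lt_ij lt_j].
- rewrite !hecke_genE; apply: quadratic_relation => //.
  have := rel _ (HeckeQuadratic q (Ordinal lt_k : 'I_n.+1.-1)).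
  exact: (etrans (esym (morph_quad pB (@hecke_piD K q n.+1) pM
    (@hecke_piZ K q n.+1) erefl _ _ _))).
- rewrite (hecke_genE (ltnW lt_k)) (hecke_genE lt_k); apply/subr0_eq.
  have := rel _ (HeckeBraid q (i := Ordinal (ltnW lt_k) : 'I_n.+1.-1) (j :=
    Ordinal lt_k) erefl).
  exact: (etrans (esym (morph_braid pB pM _ _))).
- have lt_i : (i < n)%N by lia.
  rewrite (hecke_genE lt_i) (hecke_genE lt_j); apply/subr0_eq.
  have ij : (i.+1 < j)%N || (j.+1 < i)%N by rewrite lt_ij.
  have := rel _ (HeckeCommute q (i := Ordinal lt_i : 'I_n.+1.-1) (j :=
    Ordinal lt_j) ij).
  exact: (etrans (esym (morph_commute pB pM _ _))).
Qed.

Lemma monomial_cons (i : 'I_n) (s : seq 'I_n) :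
  << FMonom (i :: s) >> = letter K (l := n.+1) i * << FMonom s >> :> free_alg.
Proof.
apply/esym/(etrans (malgM_def _ _))/(etrans (fgmulUU _ _ _ _)); rewrite mulr1.
by congr << _ *g _ >>; apply/val_inj => /=; rewrite fmM fmU.
Qed.

(** The quotient is spanned by words, and a word is built by multiplication
    by generators on the left. *)
Lemma hecke_gen_ind (S : hecke q n.+1 -> Prop) : S 1 ->
  (forall y z, S y -> S z -> S (y + z)) -> (forall a y, S y -> S (a *: y)) ->
  (forall k y, (k < n)%N -> S y -> S (hecke_gen k * y)) -> forall y, S y.
Proof.
move=> S1 SD SZ St y; have [x ->] := hecke_piP y.
have S0 : S 0 by rewrite -(scale0r 1); exact: SZ.
have Sm (m : {fmonom 'I_n}) : S (hecke_pi q (l := n.+1) << m >>).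
  case: m; elim=> [|i s IH].
    by rewrite -fmoneE; exact: S1.
  rewrite monomial_cons (hecke_piM q (letter K (l := n.+1) i)).
  have := St i _ (ltn_ord i) IH.
  by rewrite (hecke_genE (ltn_ord i)) (_ : Ordinal _ = i)//; exact/val_inj.
rewrite (monalgE x).
have pD := @hecke_piD K q n.+1; have p0 := hecke_pi0 (HeckeIdeal0 q _).
rewrite (big_morph _ pD p0).
apply: big_ind => // m _.
have -> : << x@_m *g m >> = x@_m *: << m >> :> {malg K[{fmonom 'I_n.+1.-1}]}.
  by apply/malgP => k; rewrite mcoeffZ !mcoeffU mulrnAr mulr1.
by rewrite (hecke_piZ q); exact: SZ.
Qed.

Definition delta1 w : K := (w == 1%g)%:R.
(** The coordinates of y in the basis T_w: the image of the basis vector of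
    the identity under y. *)
Definition coord (y : hecke q n.+1) w : K := hecke_act y delta1 w.

Lemma coordD y z w : coord (y + z) w = coord y w + coord z w. Proof. exact:
  hecke_actD. Qed.
Lemma coordZ a y w : coord (a *: y) w = a * coord y w. Proof. exact: hecke_actZ.
  Qed.
Lemma coord1 w : coord 1 w = (w == 1%g)%:R. Proof. exact: hecke_act1. Qed.
Lemma coord_t k y w : (k < n)%N -> coord (hecke_gen k * y) w =
  reg_op k (coord y) w.
Proof. by move=> lt_k; rewrite /coord hecke_actM hecke_act_gen. Qed.

End RegularRepresentation.

(** * Coordinates, the Hermitian form and leading coefficients *)

(** The algebra is kept abstract: only linearity of the coordinates and the
    action of the generators on them are used. *)
Section Coordinates.
Variables (K : fieldType) (q : K) (n : nat) (A : algType K) (t : nat -> A).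
Notation h := (q - q^-1).
Notation perm := ('S_n.+1).
Implicit Types (w : perm) (f g : perm -> K).
Hypothesis tH : hecke_family q n t.
Hypothesis t_gen : forall S : A -> Prop, S 1 ->
  (forall y z, S y -> S z -> S (y + z)) ->
  (forall a y, S y -> S (a *: y)) -> (forall k y, (k < n)%N -> S y ->
    S (t k * y)) ->
  forall y, S y.
Variable coord : A -> perm -> K.
Hypothesis coordD : forall y z w, coord (y + z) w = coord y w + coord z w.
Hypothesis coordZ : forall a y w, coord (a *: y) w = a * coord y w.
Hypothesis coord1 : forall w, coord 1 w = (w == 1%g)%:R.
Hypothesis coord_t : forall k y w, (k < n)%N ->
  coord (t k * y) w = reg_op q k (coord y) w.

Lemma reindex_swap k (F : perm -> K) : \sum_w F (swap k w) = \sum_w F w.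
Proof.
by rewrite [RHS](reindex_inj (h := swap k))//; exact: can_inj (swapK k).
Qed.

(** The diamond lemma provides elements T_w with T_w = t k * T_(swap k w) at
    descents, and psi f = sum_w f w *: T_w commutes with the generators;
    hence psi inverts coord, by induction on words. *)
Lemma coord_inj y : (forall w, coord y w = 0) -> y = 0.
Proof.
move=> coord0.
have [|||Tw [Tw1 TwE]] := @diamond n _ (1 : A) (fun _ k x => t k * x) predT.
- by [].
- move=> w i j x _ ij _ _ /=.
  by case: tH => _ _ far; case/andP: ij => ij lt_j; rewrite !mulrA far.
- move=> w i x _ lt_i _ _ /=; case: tH => _ braid _.
  by rewrite !mulrA braid.
pose psi f : A := \sum_w f w *: Tw w.
have psi_reg_op k f : (k < n)%N -> t k * psi f = psi (reg_op q k f).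
  move=> lt_k; have tT w : t k * Tw w
      = Tw (swap k w) + (if descent w k then (q - q^-1) *: Tw w else 0).
    case: ifP => [dw|ndw].
      rewrite {1 2}(TwE w k)// mulrA; case: tH => quad _ _.
      by rewrite quad// mulrDl mul1r -scalerAl.
    have d : descent (swap k w) k by rewrite descent_swap// ndw.
    by rewrite addr0 (TwE _ _ isT lt_k d) swapK.
  transitivity (\sum_w f w *: Tw (swap k w)
     + \sum_w (if descent w k then h * f w else 0) *: Tw w).
    rewrite mulr_sumr -big_split /=; apply: eq_bigr => w _.
    rewrite -scalerAr tT scalerDr; congr (_ + _); case: ifP => _.
      by rewrite scalerA mulrC.
    by rewrite scaler0 scale0r.
  rewrite [X in X + _](_ : _ = \sum_w f (swap k w) *: Tw w).
    by rewrite -big_split /=; apply: eq_bigr => w _; rewrite -scalerDl.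
  rewrite [RHS](reindex_inj (h := swap k))//; last exact: can_inj (swapK k).
  by apply: eq_bigr => w _; rewrite swapK.
suff psiK : psi (coord y) = y.
  by rewrite -psiK /psi big1// => w _; rewrite coord0 scale0r.
move: {coord0} y; apply: t_gen => [|y z IHy IHz|a y IH|k y lt_k IH].
- rewrite /psi (bigD1 1%g)//= coord1 eqxx scale1r Tw1 big1 ?addr0// => w /negPf.
  by rewrite coord1 => ->; rewrite scale0r.
- rewrite -{2}IHy -{2}IHz /psi -big_split /=; apply: eq_bigr => w _.
  by rewrite coordD scalerDl.
- rewrite -{2}IH /psi scaler_sumr; apply: eq_bigr => w _.
  by rewrite coordZ scalerA.
- rewrite -{2}IH psi_reg_op//; congr psi; apply/funext => w; exact: coord_t.
Qed.

Section Form.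
Variable sg : {rmorphism K -> K}.
Hypothesis sg_q : sg q = q.
Hypothesis sg_aniso : forall (I : finType) (a : I -> K),
  \sum_i sg (a i) * a i = 0 -> forall i, a i = 0.

Definition form y z : K := \sum_w sg (coord y w) * coord z w.

Lemma formDr y z1 z2 : form y (z1 + z2) = form y z1 + form y z2.
Proof. by rewrite /form -big_split; apply: eq_bigr => w _;
  rewrite coordD mulrDr. Qed.
Lemma formDl y1 y2 z : form (y1 + y2) z = form y1 z + form y2 z.
Proof. by rewrite /form -big_split; apply: eq_bigr => w _;
  rewrite coordD rmorphD mulrDl. Qed.
Lemma formZr a y z : form y (a *: z) = a * form y z.
Proof. by rewrite /form mulr_sumr; apply: eq_bigr => w _;
  rewrite coordZ mulrCA. Qed.
Lemma formZl a y z : form (a *: y) z = sg a * form y z.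
Proof. by rewrite /form mulr_sumr; apply: eq_bigr => w _;
  rewrite coordZ rmorphM mulrA. Qed.

Lemma form_t k y z : (k < n)%N -> form (t k * y) z = form y (t k * z).
Proof.
move=> lt_k; rewrite /form.
under eq_bigr do rewrite coord_t// /reg_op rmorphD mulrDl.
under [RHS]eq_bigr do rewrite coord_t// /reg_op mulrDr.
rewrite !big_split /=; congr (_ + _).
  rewrite -[RHS](reindex_swap k); apply: eq_bigr => w _; by rewrite swapK.
apply: eq_bigr => w _; case: ifP => _; last by rewrite rmorph0 mul0r mulr0.
by rewrite rmorphM rmorphB fmorphV sg_q mulrCA mulrA.
Qed.

Lemma form_aniso y : form y y = 0 -> y = 0.
Proof. by move=> f0; apply: coord_inj; exact: sg_aniso f0. Qed.
End Form.

Definition shift s (k : nat) : A := t (s + k)%N.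

Lemma coord_phi k x y z w : (k < n)%N ->
  coord (phi q t k x y * z) w
    = coord z (swap k w) + ((if descent w k then h else 0) +
      h / (x^-1 * y - 1)) * coord z w.
Proof.
move=> lt_k; rewrite /phi; set a := h / _;
  rewrite mulrDl -scalerAl mul1r coordD coordZ coord_t// /reg_op.
by case: ifP => _; ring.
Qed.

(** Multiplication by y preserves the vectors supported on arrangements with
    the label s at the place s, as do the generators t k with k > s. *)
Definition fixes s (y : A) : Prop := forall z,
  (forall w, coord z w != 0 -> label w s = s) ->
    forall w, coord (y * z) w != 0 -> label w s = s.

Lemma fixesM s y y' : fixes s y -> fixes s y' -> fixes s (y * y').
Proof. by move=> fy fy' z fz w; rewrite -mulrA; apply: fy; exact: fy'. Qed.

Lemma fixes_phi s k x y : (s < k < n)%N -> fixes s (phi q t k x y).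
Proof.
move=> /andP[lt_s lt_k] z fz w; rewrite coord_phi// => nz.
have [z1|z1] := eqVneq (coord z w) 0; last exact: fz.
have := fz (swap k w); rewrite label_swapn//; try lia; apply.
by move: nz; rewrite z1 mulr0 addr0.
Qed.

Lemma fixes1 s : fixes s 1. Proof. by move=> z fz w; rewrite mul1r;
  exact: fz. Qed.

Lemma fixes_block s ys u : (s + size ys < n)%N ->
  fixes s (block q (shift s.+1) ys u).
Proof.
elim: ys => [_|y ys IH] /= lt; first exact: fixes1.
apply: fixesM; last by apply: IH; lia.
by apply: fixes_phi; lia.
Qed.

Lemma fixes_fusion_prod s ys : (s + size ys <= n)%N ->
  fixes s (fusion_prod q (shift s.+1) ys).
Proof.
move=> le; apply: big_ind => [||j _]; [exact: fixes1|exact: fixesM|].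
by apply: fixes_block; rewrite size_take ltn_ord; have := ltn_ord j; lia.
Qed.

Fixpoint raise s k w : perm := if k is k'.+1 then swap (s + k')%N (raise s k' w)
  else w.

Lemma label_raise s k w : (s + k <= n)%N -> label w s = s ->
  label (raise s k w) (s + k)%N = s.
Proof.
move=> le ws; elim: k le => [|k IH] /= le; first by rewrite addn0.
by rewrite addnS label_swapr; [rewrite IH; lia|lia].
Qed.

Lemma raise_low s k w p : (s + k <= n)%N -> (p < s)%N -> label (raise s k w) p =
  label w p.
Proof.
by elim: k => //= k IH le lt_p; rewrite label_swapn ?IH//; lia.
Qed.

(** Each factor of the block moves the label s by at most one place, so it
    reaches the last place only if every factor contributes its generator;
    the coefficient there is that of g, whatever the arguments are. *)
Lemma block_top s (g : A) w zs u : (s + size zs <= n)%N ->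
  (forall w, coord g w != 0 -> label w s = s) -> label w s = s ->
  (forall w', coord (block q (shift s) zs u * g) w' != 0 ->
     exists2 p, (p <= s + size zs)%N & label w' p = s) /\
  coord (block q (shift s) zs u * g) (raise s (size zs) w) = coord g w.
Proof.
move=> le fg ws; elim: zs le => [|z zs IH] /= le.
  rewrite addn0 mul1r; split=> // w' nz.
  by exists s => //; exact: fg.
have lt_k : (s + size zs < n)%N by lia.
have {IH} [supp top] := IH (ltnW lt_k); rewrite -mulrA.
split=> [w'|]; rewrite [coord _ _]coord_phi//.
  have [z0|nz _] := eqVneq (coord (block q (shift s) zs u * g) w') 0;
    last first.
    by have [p le_p ps] := supp _ nz; exists p => //; lia.
  rewrite z0 mulr0 addr0 => /supp[p le_p].
  have le_pn : (p <= n)%N by lia.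
  rewrite label_swap// => ps; exists (swap_pos (s + size zs) p) => //.
  by rewrite /swap_pos; case_ifs; lia.
rewrite swapK top; apply/eqP; rewrite -subr_eq0 addrAC subrr add0r mulf_eq0.
(* The unshifted term does not contribute: its support has the label s at
   a place at most s + size zs, while here it is one place further. *)
apply/orP; right; apply: contraT => /supp[p le_p ps].
have le_pn : (p <= n)%N by lia.
have E := label_raise (ltnW lt_k) ws; rewrite -label_swapr// in E.
by have := label_inj le_pn lt_k (etrans ps (esym E)); lia.
Qed.

(** In the form of [fusion_prod_block], the fusion product of the generators
    with indices above s is applied first and fixes the label s, which the
    reversed block then moves to the end. *)
Lemma fusion_prod_top m s : (s + m = n.+1)%N -> exists2 w :
  perm, (forall p, (p < s)%N -> label w p = p) &
  forall ys, size ys = m -> generic ys -> coord (fusion_prod q (shift s) ys) w =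
    1.
Proof.
elim: m s => [|m IH] s sm.
  exists 1%g => [p lt_p|ys /size0nil->]; first by rewrite label_1//; lia.
  by rewrite /fusion_prod big_ord0 coord1 eqxx.
have [w wlow wE] := IH s.+1 ltac:(lia).
exists (raise s m w) => [p lt_p|ys].
  rewrite raise_low//; [|lia]; apply: wlow; lia.
case/lastP: ys => [//|ys u]; rewrite size_rcons => -[sz] gen.
have sH : hecke_family q m (shift s).
  have [quad braid far] := tH; rewrite /shift.
  split=> [k ?|k ?|i j ? ?]; [apply: quad|rewrite addnS;
    apply: braid|apply: far]; lia.
rewrite fusion_prod_rcons (fusion_prod_block sH)//; last by rewrite sz.
have -> : (fun k => shift s k.+1) = shift s.+1.
  by apply/funext => k; rewrite /shift addSnnS.
have fg w' : coord (fusion_prod q (shift s.+1) ys) w' != 0 -> label w' s = s.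
  rewrite -[fusion_prod _ _ _]mulr1; apply: fixes_fusion_prod; first by lia.
  move=> w''; rewrite coord1; have [-> _|] := eqVneq w'' 1%g;
    last by rewrite eqxx.
  by rewrite label_1//; lia.
have le : (s + size (rev ys) <= n)%N by rewrite size_rev; lia.
have [_ ] := block_top u le fg (wlow s (ltnSn s)).
rewrite size_rev sz => ->; apply: wE => //.
by move: gen; rewrite generic_rcons => /and3P[].
Qed.

End Coordinates.

(** * Contents along a column tableau *)

Section ColumnTableau.
Local Open Scope nat_scope.
Variables (lam : seq nat) (l : nat) (L : tableau).
Hypothesis lam_part : is_partition_of lam l.
Hypothesis L_col : is_column_tableau lam L.

Lemma mem_diagram a b : ((a, b) \in diagram lam) =
  [&& 0 < a, a <= size lam, 0 < b & b <= nth 0 lam a.-1].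
Proof.
apply/allpairsPdep/idP => [[x [y [xs ys [-> ->]]]]|/and4P[a0 al b0 bl]].
  by move: xs ys; rewrite !mem_iota !add1n !ltnS => /andP[-> ->] /andP[-> ->].
by exists a, b; rewrite !mem_iota !add1n !ltnS a0 al b0 bl.
Qed.

Lemma labels_perm : perm_eq [seq L x | x <- diagram lam] (iota 1 l).
Proof. by case: L_col => -[]; case/and3P: lam_part => _ _ /eqP <-. Qed.

Lemma labels_uniq : uniq [seq L x | x <- diagram lam].
Proof. by rewrite (perm_uniq labels_perm) iota_uniq. Qed.

Lemma L_inj x y : x \in diagram lam -> y \in diagram lam -> L x = L y -> x = y.
Proof.
move=> xd yd xy.
have H := labels_uniq; move: xd yd xy.
move=> /(nthP (0, 0))[i lt_i <-] /(nthP (0, 0))[j lt_j <-].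
rewrite -!(nth_map (0, 0) 0)// => /eqP; rewrite nth_uniq ?size_map//.
by move/eqP ->.
Qed.

Lemma L_bound x : x \in diagram lam -> 0 < L x <= l.
Proof.
move=> xd; have : L x \in [seq L x | x <- diagram lam] by apply: map_f.
by rewrite (perm_mem labels_perm) mem_iota add1n ltnS.
Qed.

Lemma box_ofP i : i < l -> box_of lam L i.+1 \in diagram lam /\
  L (box_of lam L i.+1) = i.+1.
Proof.
move=> lt_i; have : i.+1 \in [seq L x | x <- diagram lam].
  by rewrite (perm_mem labels_perm) mem_iota add1n ltnS.
move=> im; have lt := im; rewrite -index_mem size_map in lt.
split; first exact: mem_nth.
by rewrite /box_of -(nth_map _ 0)// nth_index.
Qed.

Lemma box_of_L x : x \in diagram lam -> box_of lam L (L x) = x.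
Proof.
move=> xd; have [L0 Ll] := andP (L_bound xd).
have [bd bL] := @box_ofP (L x).-1 ltac:(lia).
rewrite prednK// in bd bL; exact: L_inj bd xd bL.
Qed.

Lemma diagram_down a b a' b' : (a', b') \in diagram lam -> 0 < a <= a' ->
  0 < b <= b' ->
  (a, b) \in diagram lam.
Proof.
rewrite !mem_diagram => /and4P[a'0 a'l b'0 b'l] /andP[a0 aa'] /andP[b0 bb'].
rewrite a0 b0 (leq_trans aa' a'l) (leq_trans bb')//; apply: leq_trans b'l _.
case/and3P: lam_part => srt _ _.
have geq_trans : transitive geq by move=> x y z /= yx zy;
  exact: leq_trans zy yx.
apply: (sorted_leq_nth geq_trans _ 0 srt); rewrite ?inE; try lia.
by move=> x /=.
Qed.

(** Down the column, then along the row. *)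
Lemma L_mono a b a' b' : (a, b) \in diagram lam -> (a', b') \in diagram lam ->
  a <= a' -> b <= b' -> L (a, b) <= L (a', b').
Proof.
move=> d d' aa bb; have [[_ std] _] := L_col.
have pos : 0 < a /\ 0 < b by move: d; rewrite mem_diagram => /and4P[].
have col k : a + k <= a' -> L (a, b) <= L (a + k, b).
  elim: k => [_|k IH le]; first by rewrite addn0.
  rewrite addnS in le *; apply: leq_trans (IH (ltnW le)) _.
  have d1 : (a + k, b) \in diagram lam by apply: diagram_down d' _ _; lia.
  by apply/ltnW/(std _ _ d1).1/(diagram_down d'); lia.
have row k : b + k <= b' -> L (a', b) <= L (a', b + k).
  elim: k => [_|k IH le]; first by rewrite addn0.
  rewrite addnS in le *; apply: leq_trans (IH (ltnW le)) _.
  have d1 : (a', b + k) \in diagram lam by apply: diagram_down d' _ _; lia.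
  by apply/ltnW/(std _ _ d1).2/(diagram_down d'); lia.
have := col (a' - a); have := row (b' - b); rewrite !subnKC//.
by move=> /(_ (leqnn _)) r /(_ (leqnn _)) /leq_trans; apply.
Qed.

Lemma L_mono_lt a b a' b' : (a, b) \in diagram lam ->
  (a', b') \in diagram lam ->
  a <= a' -> b <= b' -> (a, b) <> (a', b') -> L (a, b) < L (a', b').
Proof.
move=> d d' aa bb ne; rewrite ltn_neqAle L_mono// andbT.
by apply/eqP => /(L_inj d d').
Qed.

Definition label_content i : int := content lam L i.+1.
Definition label_col i : nat := (box_of lam L i.+1).2.
Definition label_row i : nat := (box_of lam L i.+1).1.

Lemma boxE i : box_of lam L i.+1 = (label_row i, label_col i).
Proof. exact: surjective_pairing. Qed.

Lemma label_contentE i : label_content i =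
  ((label_col i)%:Z - (label_row i)%:Z)%R.
Proof. by []. Qed.

Lemma box_spec i : i < l -> [/\ (label_row i, label_col i) \in diagram lam,
  L (label_row i, label_col i) = i.+1,
  0 < label_row i & 0 < label_col i].
Proof.
move=> /box_ofP; rewrite boxE => -[d E]; split=> //;
  by move: d; rewrite mem_diagram => /and4P[].
Qed.

(** A box on the same diagonal that is not strictly south-east is weakly
    north-west, where the labels are smaller. *)
Lemma label_content_diag i j : i < j < l -> label_content i = label_content j ->
  label_row i < label_row j /\ label_col i < label_col j.
Proof.
move=> /andP[lt_ij lt_j]; rewrite !label_contentE => E.
have [di Li ri ci] := box_spec (ltn_trans lt_ij lt_j).
have [dj Lj rj cj] := box_spec lt_j.
case: (ltnP (label_row i) (label_row j)) => [lt_r|le_r]; first by split; lia.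
have := L_mono dj di le_r; rewrite Li Lj => /(_ ltac:(lia)); lia.
Qed.

(** The box below that of i is weakly north-west of the box of j, and its
    label is i + 1 since columns are filled consecutively. *)
Lemma label_content_repeat i j : i < j < l ->
  label_content i = label_content j ->
  [/\ i.+1 < j, label_col i.+1 = label_col i & label_content i.+1 =
    (label_content i - 1)%R].
Proof.
move=> ij E; have [rr cc] := label_content_diag ij E;
  case/andP: ij => lt_ij lt_j.
have [di Li ri ci] := box_spec (ltn_trans lt_ij lt_j).
have [dj Lj rj cj] := box_spec lt_j.
have d1 : ((label_row i).+1, label_col i) \in diagram lam by apply: diagram_down
  dj _ _; lia.
have L1 : L ((label_row i).+1, label_col i) = i.+2 by have [_ ->] := L_col;
  rewrite ?Li.
have lt1 : i.+1 < j.
  have := L_mono_lt d1 dj rr (ltnW cc); rewrite L1 Lj => H.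
  by apply: H => -[_ ?]; lia.
have B : box_of lam L i.+2 = ((label_row i).+1, label_col i) by rewrite -L1
  box_of_L.
split=> //; first by rewrite /label_col B.
rewrite [label_content i]label_contentE /label_content /content B /=; lia.
Qed.

Lemma label_content_col i j : i < j < l -> label_col i = label_col j ->
  label_content i <> label_content j.
Proof. by move=> ij cc E; have [_] := label_content_diag ij E;
  rewrite cc ltnn. Qed.

Hypothesis l_gt0 : 0 < l.

(** Below the first row the box above carries the previous label. In the
    first row the box to the left has the content one less, and no smaller
    label lies on the same diagonal, as its box would be in a higher row. *)
Lemma label_content_next m : 0 < m < l ->
  (label_col m = label_col m.-1 /\ label_content m = (label_content m.-1 - 1)%R)
    \/
  ((forall i, i < m -> label_content i <> label_content m) /\
    exists2 i, i < m & label_content m = (label_content i + 1)%R).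
Proof.
move=> /andP[m0 lt_m]; have [d Lm r0 c0] := box_spec lt_m.
case: (ltnP 1 (label_row m)) => [r1|r1]; [left|right].
  have d1 : ((label_row m).-1, label_col m) \in diagram lam by apply:
    diagram_down d _ _; lia.
  have L1 : L ((label_row m).-1, label_col m) = m.
    have [_ /(_ _ _ d1)] := L_col; rewrite prednK// => /(_ d).
    by rewrite Lm => -[].
  have B : box_of lam L m = ((label_row m).-1, label_col m) by rewrite -{1}L1
    box_of_L.
  rewrite /label_col /label_content prednK// /content B boxE /=; split=> //;
    lia.
split=> [i lt_i E|].
  have [] := label_content_diag (i := i) (j := m) _ E; first by rewrite lt_i.
  have [_ _ + _] := box_spec (ltn_trans lt_i lt_m); lia.
have rm1 : label_row m = 1 by lia.
have c1 : 1 < label_col m.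
  rewrite ltnNge; apply/negP => le1.
  have [d0 L0 r00 c00] := box_spec l_gt0.
  have := L_mono d d0; rewrite Lm L0; lia.
have d1 : (1, (label_col m).-1) \in diagram lam by apply: diagram_down d _ _;
  lia.
have lt1 : L (1, (label_col m).-1) < m.+1.
  by rewrite -Lm; apply: L_mono_lt => //; [lia..|case; lia].
have [L0 _] := andP (L_bound d1).
exists (L (1, (label_col m).-1)).-1; first lia.
rewrite label_contentE /label_content prednK// /content box_of_L//= rm1; lia.
Qed.

Lemma label_content0 : label_content 0 = 0%R.
Proof.
have [d L1 r c] := box_spec l_gt0.
have d1 : (1, 1) \in diagram lam by apply: diagram_down d _ _; lia.
have [L0 _] := andP (L_bound d1).
have E : L (1, 1) = 1.
  by apply/eqP; rewrite eqn_leq L0 andbT -[X in _ <= X]L1; exact: L_mono.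
by rewrite /label_content /content -E box_of_L.
Qed.
End ColumnTableau.

(** * Conjugation on the field C(q) *)

Section FractionLift.
Variables (P : idomainType) (F : fieldType) (f : {rmorphism P -> F}).
Hypothesis f_inj : injective f.

Lemma frac_repr (x : {fraction P}) :
  x = tofrac (frac (repr x)).1 / tofrac (frac (repr x)).2.
Proof.
have d0 := denom_ratioP (repr x).
have td : tofrac (frac (repr x)).2 != 0 :> {fraction P} by rewrite tofrac_eq0.
apply: (canRL (mulfK td)); rewrite -{1}[x]reprK; move: (repr x) d0 => r d0.
unlock FracField.tofrac; rewrite -[LHS]FracField.pi_mul; apply/eqmodP => /=.
rewrite FracField.equivfE /FracField.mulf.
by rewrite !numden_Ratio ?mulr1 ?oner_neq0 ?numden_Ratio ?mulr1 ?oner_neq0//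
  mulrC.
Qed.

Lemma fracE (x : {fraction P}) : exists a b, b != 0 /\ x = tofrac a / tofrac b.
Proof.
by exists (frac (repr x)).1, (frac (repr x)).2; split;
  [exact: denom_ratioP|exact: frac_repr].
Qed.

(** The extension of f to fractions, computed on a representative. *)
Definition fraction_lift (x : {fraction P}) : F :=
  f (frac (repr x)).1 / f (frac (repr x)).2.

Lemma lift_neq0 a : a != 0 -> f a != 0.
Proof. by rewrite -(inj_eq f_inj) rmorph0. Qed.

Lemma fraction_liftE a b : b != 0 -> fraction_lift (tofrac a / tofrac b) =
  f a / f b.
Proof.
move=> b0; set x := _ / _; have d0 := denom_ratioP (repr x).
have := frac_repr x; rewrite /fraction_lift;
  move: (frac (repr x)).1 (frac (repr x)).2 d0 => n d d0.
move=> /eqP; rewrite /x eqr_div ?tofrac_eq0// -!rmorphM tofrac_eq => /eqP E.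
by apply/eqP; rewrite eqr_div ?lift_neq0// -!rmorphM E.
Qed.

Lemma fraction_lift_zmod : zmod_morphism fraction_lift.
Proof.
move=> x y; have [a [b [b0 ->]]] := fracE x; have [c [d [d0 ->]]] := fracE y.
have -> : tofrac a / tofrac b - tofrac c / tofrac d = tofrac (a * d - c * b) /
  tofrac (b * d).
  by rewrite -mulNr addf_div ?tofrac_eq0// mulNr rmorphB !rmorphM.
rewrite !fraction_liftE ?mulf_neq0// -[in RHS]mulNr addf_div ?lift_neq0//.
by rewrite mulNr rmorphB !rmorphM.
Qed.

Lemma fraction_lift_monoid : monoid_morphism fraction_lift.
Proof.
split=> [|x y].
  have -> : 1 = tofrac 1 / tofrac 1 :> {fraction P} by rewrite rmorph1 divr1.
  by rewrite fraction_liftE ?oner_eq0// rmorph1 divr1.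
have [a [b [b0 ->]]] := fracE x; have [c [d [d0 ->]]] := fracE y.
rewrite mulf_div -!rmorphM !fraction_liftE ?mulf_neq0// !rmorphM.
by rewrite mulf_div.
Qed.

HB.instance Definition _ := GRing.isZmodMorphism.Build _ _ fraction_lift
  fraction_lift_zmod.
HB.instance Definition _ := GRing.isMonoidMorphism.Build _ _ fraction_lift
  fraction_lift_monoid.

Lemma fraction_lift_tofrac a : fraction_lift (tofrac a) = f a.
Proof.
have -> : tofrac a = tofrac a / tofrac 1 by rewrite rmorph1 divr1.
by rewrite fraction_liftE ?oner_eq0// rmorph1 divr1.
Qed.

Lemma fraction_lift_ex : exists g : {rmorphism {fraction P} -> F}, forall a,
  g (tofrac a) = f a.
Proof. by exists fraction_lift; exact: fraction_lift_tofrac. Qed.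
End FractionLift.

Section Cq.
Import Num.Theory.
Variable R : realType.
Notation C := R[i].
Notation q := (Cq_q R).

Lemma Cq_q_neq0 : q != 0.
Proof. by rewrite tofrac_eq0 polyX_eq0. Qed.

Lemma Cq_q_exp_neq1 n : (0 < n)%N -> q ^+ n != 1.
Proof.
move=> n0; rewrite -(rmorphXn (@tofrac _)) -(rmorph1 (@tofrac _)) tofrac_eq.
apply/eqP => /(congr1 (fun p : {poly C} => size p)).
by rewrite size_polyXn size_poly1 => -[] n1; rewrite n1 in n0.
Qed.

Lemma Cq_char0 n : (0 < n)%N -> n%:R != 0 :> Cq R.
Proof.
move=> n0; rewrite -(rmorph_nat (@tofrac _)) tofrac_eq0 -polyC_natr polyC_eq0.
by rewrite pnatr_eq0 -lt0n.
Qed.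

Definition conj_poly (p : {poly C}) : {poly C} :=
  map_poly (Num.conj : C -> C) p.
Definition conj_frac : {rmorphism {poly C} -> Cq R} :=
  (@tofrac _ \o map_poly (Num.conj : C -> C)).

Lemma conj_frac_inj : injective conj_frac.
Proof.
move=> p p' /eqP /=; rewrite tofrac_eq => /eqP/map_poly_inj; exact.
Qed.

(** At a natural number the sum becomes a sum of squared moduli, so every p
    i vanishes at infinitely many points. *)
Lemma sum_conj_poly_eq0 (I : finType) (p : I -> {poly C}) :
  \sum_i conj_poly (p i) * p i = 0 -> forall i, p i = 0.
Proof.
move=> E i; have pn n : (p i).[n%:R] = 0.
  have := congr1 (fun P : {poly C} => P.[n%:R]) E; rewrite horner_sum horner0.
  under eq_bigr => j _.
    rewrite hornerM -[X in (conj_poly _).[X]](rmorph_nat (Num.conj :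
      {rmorphism C -> C})).
    rewrite horner_map mulrC -normCK; over.
  move=> /psumr_eq0P-/(_ (fun j _ => exprn_ge0 2 (normr_ge0 _)) i isT)/eqP.
  by rewrite expf_eq0 normr_eq0 => /eqP.
apply/eqP; apply: contraT => p0.
have := max_poly_roots (rs := [seq n%:R | n <- iota 0 (size (p i))]) p0.
rewrite size_map size_iota ltnn map_inj_uniq ?iota_uniq; last first.
  by move=> m n /eqP; rewrite eqr_nat => /eqP.
move=> -> //; apply/allP => _ /mapP[n _ ->]; exact/eqP.
Qed.

(** Conjugation of the coefficients. After reduction to a common
    denominator, anisotropy is [sum_conj_poly_eq0]. *)
Lemma conj_Cq_ex : exists sg : {rmorphism Cq R -> Cq R}, sg q = q /\
  forall (I : finType) (a : I -> Cq R), \sum_i sg (a i) * a i = 0 ->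
    forall i, a i = 0.
Proof.
have [sg sgE] := fraction_lift_ex conj_frac_inj.
exists sg; split; first by rewrite sgE /= map_polyX.
move=> I a a0.
have ex i : exists pd : {poly C} * {poly C}, pd.2 != 0 /\
  a i = tofrac pd.1 / tofrac pd.2.
  by have [p [d [d0 ->]]] := fracE (a i); exists (p, d).
have [pd pdE] := boolp.choice ex.
pose d := \prod_i (pd i).2; pose p i := (pd i).1 * \prod_(j | j != i) (pd j).2.
have d0 : d != 0 by apply/prodf_neq0 => i _; case: (pdE i).
have aE i : a i = tofrac (p i) / tofrac d.
  have [di ->] := pdE i; apply/eqP; rewrite eqr_div ?tofrac_eq0// -!rmorphM
    tofrac_eq.
  by rewrite /d /p (bigD1 i)//= mulrA mulrAC.
have p0 : forall i, p i = 0.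
  apply: sum_conj_poly_eq0; apply/eqP; rewrite -tofrac_eq0 rmorph_sum /=.
  have cd0 : tofrac (conj_poly d) * tofrac d != 0 :> Cq R.
    by rewrite mulf_neq0// ?tofrac_eq0// map_poly_eq0.
  rewrite -(inj_eq (mulIf (invr_neq0 cd0))) mul0r mulr_suml -[X in _ == X]a0.
  apply/eqP/eq_bigr => i _; rewrite aE fmorph_div !sgE /= tofracM.
  by rewrite invfM mulrACA.
by move=> i; rewrite aE p0 rmorph0 mul0r.
Qed.
End Cq.

(** * Irreducibility *)

Lemma inc_prodE (K : fieldType) (A : algType K) (f : nat -> A) k :
  inc_prod f k = \prod_(i < k) f i.
Proof. by elim: k => [|k IH] /=; rewrite ?big_ord0// big_ord_recr IH. Qed.

Lemma fusion_prodE (K : fieldType) (q : K) (A : algType K) (t : nat -> A) ys :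
  fusion_prod q t ys = \prod_(j < size ys) \prod_(i < size ys | (i < j)%N)
    phi q t (j - i.+1)%N ys`_i ys`_j.
Proof.
apply: eq_bigr => j _; have lt_j := ltn_ord j.
rewrite block_inc_prod inc_prodE size_takel 1?ltnW//.
rewrite (big_ord_widen (size ys) (fun i => phi q t (j - i.+1) (take j ys)`_i
  ys`_j)) 1?ltnW//.
by apply: eq_bigr => i lt_i; rewrite nth_take.
Qed.

Lemma fusion_funE (K : fieldType) (q : K) (n : nat) (lam : seq nat) (L :
  tableau)
    (z : 'I_n.+1 -> K) :
  fusion_fun q lam L z = fusion_prod q (hecke_gen q n)
    (take n.+1 (args q (label_content lam L) z)).
Proof.
rewrite take_oversize ?size_args// fusion_prodE size_args; apply: eq_bigr =>
  j _.
apply: eq_bigr => i lt_i; rewrite !nth_args /hecke_F /phi /hecke_gen.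
by rewrite subnSK.
Qed.

Lemma regular_value_linear (K : fieldType) (l : nat) (Z D : set ('I_l -> K)) p
    (M N : lmodType K) (g : M -> N) (f : ('I_l -> K) -> M) v :
  (forall y z, g (y + z) = g y + g z) -> (forall a y, g (a *: y) = a *: g y) ->
  regular_value Z D f p v -> regular_value Z D (fun z => g (f z)) p (g v).
Proof.
move=> gD gZ; have g0 : g 0 = 0 by have := gZ 0 0; rewrite !scale0r.
have gsum n (F : 'I_n -> M) : g (\sum_k F k) = \sum_k g (F k) by exact:
  (big_morph g gD g0).
case=> n [P [Q [w [Qp fE ->]]]]; exists n, P, Q, (g \o w);
  split=> // [z Zz Dz Qz|].
  by rewrite fE// gsum; apply: eq_bigr => k _; rewrite gZ.
by rewrite gsum; apply: eq_bigr => k _; rewrite gZ.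
Qed.

Section FusionElement.
Variables (R : realType) (n : nat) (lam : seq nat) (L : tableau).
Notation l := n.+1.
Hypothesis lam_part : is_partition_of lam l.
Hypothesis L_col : is_column_tableau lam L.
Notation K := (Cq R).
Notation q := (Cq_q R).
Notation F := (fusion_elt q l lam L).
Notation t := (hecke_gen q n).

Let q0 := Cq_q_neq0 R.
Let q_gen := @Cq_q_exp_neq1 R.
Let ch0 := @Cq_char0 R.
Let tH := hecke_family_gen n q0.
Let c0 := label_content0 lam_part L_col (ltn0Sn n).
Let c_rep := label_content_repeat lam_part L_col.
Let c_next := label_content_next lam_part L_col (ltn0Sn n).
Let c_col := label_content_col lam_part L_col.

Lemma fusion_regular : regular_value (same_column_space lam L)
  (fusion_dom q lam L)
  (fun z : 'I_l -> K => fusion_prod q t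
    (take l (args q (label_content lam L) z))) (fun=> 1) F.
Proof.
have [v vE] := fusion_prod_regular q0 q_gen c_rep (m := l) tH (leqnn l).
have : [set v | regular_value (same_column_space lam L)
     (fusion_dom q lam L) (fusion_fun q lam L) (fun=> 1) v]%classic F.
  apply: xgetPex; exists v => /=.
  apply: regular_value_ext vE => z _ _; exact: fusion_funE.
by apply: regular_value_ext => z _ _; rewrite fusion_funE.
Qed.

Lemma fusion_weight k : (k <= n)%N ->
  jm t k * F = q ^ (2 * label_content lam L k) *: F.
Proof.
move=> le_k; exact: (left_weights q0 q_gen c_rep ch0 c_col c0 c_next (m := l) tH
  (leqnn l) fusion_regular).
Qed.

Let coordD := @coordD K q n q0.
Let coordZ := @coordZ K q n q0.
Let coord1 := @coord1 K q n q0.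
Let coord_t := @coord_t K q n q0.

(** The coordinate at the longest element is a linear function of the fusion
    product that is constant equal to 1, and so is its value. *)
Lemma fusion_neq0 : F <> 0.
Proof.
have [w _ wE] := fusion_prod_top tH coordD coordZ coord1 coord_t (add0n l).
have E : coord F w = 1.
  have H := regular_value_linear (N := K^o) (g := fun y => coord y w)
    (fun y z => coordD y z w) (fun a y => coordZ a y w) fusion_regular.
  have := col_value_uniq q0 q_gen ch0 c_col H; apply.
  apply: regular_value_ext (regular_value_cst _ _ _ _) => z Zz Dz.
  apply: wE; first by rewrite take_oversize size_args.
  exact: generic_args.
move=> F0; move: E; rewrite F0 -(scale0r 0) coordZ mul0r => /eqP.
by rewrite eq_sym oner_eq0.
Qed.

Lemma fusion_minimal (W : hecke q l -> Prop) y :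
  (forall a z, W z -> W (a * z)) -> W (y * F) -> y * F <> 0 -> W F.
Proof.
have [sg [sg_q aniso]] := conj_Cq_ex R.
have sgX (m : int) : sg (q ^ m) = q ^ m by rewrite fmorphXz sg_q.
have gen := hecke_gen_ind (q := q) (n := n).
exact: (weight_vector_minimal q0 q_gen tH gen sgX
  (formDr coordD sg) (formZr coordZ sg) (formDl coordD sg) (formZl coordZ sg)
  (form_t coord_t sg_q) (form_aniso tH gen coordD coordZ coord1 coord_t aniso)
    fusion_weight).
Qed.

End FusionElement.

Theorem corollary3p5 (R : realType) (l : nat) (l_gt0 : (0 < l)%N)
    (lam : seq nat) (lam_part : is_partition_of lam l)
    (L : tableau) (L_col : is_column_tableau lam L) :
  irreducible_submodule
    (principal_left_ideal (fusion_elt (Cq_q R) l lam L)).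
Proof.
case: l l_gt0 lam_part => // n _ lam_part.
set F := fusion_elt _ _ _ _; pose A := hecke (Cq_q R) n.+1.
have idealP (x : A) : reflect (exists a : A, x = a * F)
  (x \in principal_left_ideal F).
  exact: asboolP.
split.
- split; first by apply/idealP; exists 0; rewrite mul0r.
  move=> a u v /idealP[x ->] /idealP[y ->]; apply/idealP.
  by exists (a * x + y); rewrite mulrDl -mulrA.
- exists F; first by apply/idealP; exists 1; rewrite mul1r.
  exact/eqP/(fusion_neq0 lam_part L_col).
move=> W [W0 Wlin] WV.
have WM (a z : A) : z \in W -> a * z \in W.
  by move=> Wz; rewrite -[a * z]addr0; exact: Wlin.
have [[x [Wx x0]]|nx] := pselect (exists x : A, x \in W /\ x <> 0);
  [right|left]; last first.
  move=> x; rewrite inE; apply/idP/eqP => [Wx|->//].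
  by apply: contrapT => x0; apply: nx; exists x.
have /idealP[y xE] := WV _ Wx.
have WF : F \in W.
  apply: (fusion_minimal lam_part L_col (W := fun z => z \in W) (y := y)) => //.
    by rewrite -xE.
  by rewrite -/F -xE.
by move=> z; apply/idP/idP => [/WV//|/idealP[a ->]]; exact: WM.
Qed.
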